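(* Let $0\le\gamma<2\pi$ and let $f=h+\overline{g}\in\mathcal{S}^0(H_\gamma)$ have dilatation $\omega(z)=g'(z)/h'(z)=e^{i\theta}z^n$, where $n\in\{1,2\}$ and $\theta\in\mathbb{R}$. Then $f_0\ast f\in\mathcal{S}_H^0$ and $f_0\ast f$ is convex in the direction $-\gamma$.
   Context: Let $\mathbb{D}=\{z\in\mathbb{C}:|z|<1\}$. $\mathcal{H}$ is the class of complex-valued harmonic functions $f=h+\overline{g}$ on $\mathbb{D}$ with $h,g$ analytic on $\mathbb{D}$ of the form $h(z)=z+\sum_{n\ge2}a_nz^n$, $g(z)=\sum_{n\ge1}b_nz^n$. The complex dilatation of $f$ is $\omega=g'/h'$. $\mathcal{S}_H$ is the class of univalent sense-preserving $f\in\mathcal{H}$ (sense-preserving: $|h'(z)|^2-|g'(z)|^2>0$ in $\mathbb{D}$), and $\mathcal{S}_H^0=\{f\in\mathcal{S}_H: b_1=f_{\overline z}(0)=0\}$. For $0\le\gamma<2\pi$, let $H_\gamma=\{w\in\mathbb{C}:\operatorname{Re}(e^{i\gamma}w)>-1/2\}$, and let $\mathcal{S}^0(H_\gamma)$ be the class of all $f\in\mathcal{S}_H^0$ with $f(\mathbb{D})=H_\gamma$. The harmonic convolution of $f=h+\overline g$ and $F=H+\overline G$ in $\mathcal{H}$, with $H(z)=z+\sum_{n\ge2}A_nz^n$, $G(z)=\sum_{n\ge1}B_nz^n$, is $(f\ast F)(z)=z+\sum_{n\ge2}a_nA_nz^n+\sum_{n\ge1}\overline{b_nB_n}\,\overline{z}^{\,n}$.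 Fix $f_0=h_0+\overline{g_0}$ with $h_0(z)=\frac{z-z^2/2}{(1-z)^2}$ and $g_0(z)=\frac{-z^2/2}{(1-z)^2}$. A domain $\Omega\subset\mathbb{C}$ is convex in the direction $\alpha\in\mathbb{R}$ if for every $c\in\mathbb{C}$ the set $\Omega\cap\{c+te^{i\alpha}:t\in\mathbb{R}\}$ is connected or empty; a univalent harmonic mapping of $\mathbb{D}$ is convex in the direction $\alpha$ if its image $f(\mathbb{D})$ is. *)

(* Defs.v *)
From mathcomp Require Import all_boot all_order all_algebra.
From mathcomp Require Import complex.
From mathcomp Require Import all_classical all_reals all_analysis.

Set Implicit Arguments.
Unset Strict Implicit.
Unset Printing Implicit Defensive.

Import Order.TTheory GRing.Theory Num.Theory.
Import numFieldNormedType.Exports.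

Local Open Scope ring_scope.
Local Open Scope classical_set_scope.

(* The named constant carries the generic topology of a numClosedFieldType
   (balls for the modulus); the bare type R[i] has no topological structure. *)
Definition Cplx (R : realType) : numClosedFieldType := R[i].

Section HarmonicMaps.
Variable R : realType.
Local Notation C := (Cplx R).

Definition unit_disk : set C := [set z | `|z| < 1].

Definition expi (t : R) : C := (cos t +i* sin t)%C.

(* Over the field C, derivability in the direction 1 is complex
   differentiability. *)
Definition analytic_on_disk (h : C -> C) : Prop :=
  forall z, unit_disk z -> derivable h z 1.

Definition taylor_coef (h : C -> C) (n : nat) : C := derive1n n h 0 / n`!%:R.

Definition has_taylor_expansion (h : C -> C) : Prop :=
  forall z, unit_disk z ->
    series (fun n => taylor_coef h n * z ^+ n) n @[n --> \oo] --> h z.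

(* f = h + conj g is given by the pair (h, g), which f determines on the disk
   once g(0) = 0; only the values on the disk matter. *)
Record harmonic_map := HarmonicMap {
  analytic_part : C -> C;
  coanalytic_part : C -> C
}.

Definition harmonic_fun (f : harmonic_map) (z : C) : C :=
  analytic_part f z + (coanalytic_part f z)^*.

Coercion harmonic_fun : harmonic_map >-> Funclass.

(* The Taylor expansions follow from analyticity; they are part of the
   definition because Cauchy's theorem is not in the libraries. *)
Definition class_H (f : harmonic_map) : Prop :=
  let h := analytic_part f in
  let g := coanalytic_part f in
  [/\ analytic_on_disk h /\ analytic_on_disk g,
      has_taylor_expansion h /\ has_taylor_expansion g,
      taylor_coef h 0 = 0, taylor_coef h 1 = 1 & taylor_coef g 0 = 0].

Definition dilatation (f : harmonic_map) (z : C) : C :=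
  derive1 (coanalytic_part f) z / derive1 (analytic_part f) z.

Definition sense_preserving (f : harmonic_map) : Prop :=
  forall z, unit_disk z ->
    0 < `|derive1 (analytic_part f) z| ^+ 2 - `|derive1 (coanalytic_part f) z| ^+ 2.

Definition class_SH (f : harmonic_map) : Prop :=
  [/\ class_H f, set_inj unit_disk f & sense_preserving f].

Definition class_SH0 (f : harmonic_map) : Prop :=
  class_SH f /\ taylor_coef (coanalytic_part f) 1 = 0.

Definition half_plane (gamma : R) : set C :=
  [set w | - 2^-1 < complex.Re (expi gamma * w)].

Definition class_SH0_half_plane (gamma : R) (f : harmonic_map) : Prop :=
  class_SH0 f /\ f @` unit_disk = half_plane gamma.

Definition hadamard (h H : C -> C) (z : C) : C :=
  limn (series (fun n => taylor_coef h n * taylor_coef H n * z ^+ n)).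

(* On class_H the leading terms agree with the usual formula: the product of
   the coefficients of index 0 is 0, and that of the analytic parts at index 1
   is 1. *)
Definition convolution (f F : harmonic_map) : harmonic_map :=
  HarmonicMap (hadamard (analytic_part f) (analytic_part F))
              (hadamard (coanalytic_part f) (coanalytic_part F)).

Definition f0 : harmonic_map :=
  HarmonicMap (fun z => (z - z ^+ 2 / 2) / (1 - z) ^+ 2)
              (fun z => (- (z ^+ 2 / 2)) / (1 - z) ^+ 2).

Definition line (c : C) (alpha : R) : set C :=
  [set c + (t%:C)%C * expi alpha | t in [set: R]].

Definition convex_in_direction (alpha : R) (Omega : set C) : Prop :=
  forall c : C, let S := Omega `&` line c alpha in connected S \/ S = set0.

Definition map_convex_in_direction (alpha : R) (f : harmonic_map) : Prop :=
  convex_in_direction alpha (f @` unit_disk).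

End HarmonicMaps.

(* Main.v *)
Require Import Defs.
From mathcomp Require Import all_boot all_order all_algebra.
From mathcomp Require Import complex.
From mathcomp Require Import all_classical all_reals all_analysis.
From mathcomp Require Import ring lra zify.
Set Implicit Arguments.
Unset Strict Implicit.
Unset Printing Implicit Defensive.
Import Order.TTheory GRing.Theory Num.Theory.
Import numFieldNormedType.Exports.
Local Open Scope ring_scope.
Local Open Scope classical_set_scope.

(** Write x for exp(i gamma), y for its conjugate, u = xz and v = u / (1 - u); the
    last function maps the disk onto the half-plane Re v > -1/2.

    The function xh + yg has the same real part as xf, so its values lie in the
    half-plane Re > -1/2; it vanishes at 0 with derivative x, of modulus 1. By the
    equality case of the Schwarz lemma, xh + yg = v ([caratheodory_extremal],
    [half_plane_combination]). The proof given here works on the coefficients and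
    needs only finite sums over roots of unity: a positive measure on the circle,
    of mass 1 and with first moment x, is the point mass at x.

    Convolution with h0 and g0 is the differential operator (h + zh') / 2,
    respectively (g - zg') / 2. Together with g' = exp(i theta) z^n h', the identity
    above expresses h', zh'' and zg'' rationally in u, and so the dilatation of
    the convolution H + conj G. Up to unimodular constants it is u^2 for n = 2; for
    n = 1 it is u times the quotient of the quadratic polynomial
    1 + u + 2cu^2 by its reciprocal. In both cases it is less than 1 in modulus
    ([conv_dilatation_lt]), so the convolution preserves orientation.

    For univalence and convexity, rotate the convolution by x. Its imaginary part is
    that of the analytic function Phi = xH - yG, and its real part is that of
    K = xH + yG. As functions of v, the derivative of Phi is 1 / (1 + w) + v with
    |w| < 1 ([shear_value]), hence has real part greater than Re v + 1/2. So Im Phi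
    increases from minus to plus infinity on every vertical line Re v = t, and each
    of its level sets is the graph of a differentiable function over the whole
    interval t > -1/2. Along such a curve Re K is strictly increasing, because the
    derivatives L of K and Q of Phi satisfy Re (L conj Q) > 0, which again says
    that the convolution preserves orientation ([level_ReK_deriv]). Thus no value
    is taken twice ([shear_injective]), and the image meets each horizontal line in
    an interval ([shear_level_connected]); rotating back, horizontal lines become
    lines in the direction -gamma. *)

(** * The modulus as a real number, and convergence in the complex plane *)

Section ComplexModulus.
Variable R : realType.
Local Notation C := (Cplx R).
Local Notation Re := (@complex.Re R).
Local Notation Im := (@complex.Im R).
Implicit Types z w : C.

(** The norm of the field C takes its values in C. Estimates are carried out with
    this real-valued copy, for which linear arithmetic over R is available. *)
Definition cmod z : R := Re `|z|.

Lemma normcE_cmod z : `|z| = ((cmod z)%:C)%C.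
Proof. by rewrite /cmod RRe_real // normr_real. Qed.

Lemma cmodE z : cmod z = Num.sqrt (Re z ^+ 2 + Im z ^+ 2).
Proof. by rewrite /cmod normc_def. Qed.

Lemma sqr_cmod z : cmod z ^+ 2 = Re z ^+ 2 + Im z ^+ 2.
Proof. by rewrite cmodE sqr_sqrtr // addr_ge0 // sqr_ge0. Qed.

Lemma cmod_ge0 z : 0 <= cmod z.
Proof. by rewrite cmodE sqrtr_ge0. Qed.

Lemma cmod0 : cmod 0 = 0.
Proof. by rewrite /cmod normr0. Qed.

Lemma cmod1 : cmod 1 = 1.
Proof. by rewrite /cmod normr1. Qed.

Lemma cmodN z : cmod (- z) = cmod z.
Proof. by rewrite /cmod normrN. Qed.

Lemma cmodM z w : cmod (z * w) = cmod z * cmod w.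
Proof. by rewrite {1}/cmod normrM !normcE_cmod /= mulr0 subr0. Qed.

Lemma cmodV z : cmod z^-1 = (cmod z)^-1.
Proof. by apply: complexI; rewrite -normcE_cmod normfV normcE_cmod fmorphV. Qed.

Lemma cmodX z n : cmod (z ^+ n) = cmod z ^+ n.
Proof. by elim: n => [|n IH]; rewrite ?expr0 ?cmod1 // !exprS cmodM IH. Qed.

Lemma cmodD z w : cmod (z + w) <= cmod z + cmod w.
Proof.
have := ler_normD z w.
by rewrite !normcE_cmod -(rmorphD (real_complex R)) lecR.
Qed.

Lemma cmodB z w : cmod (z - w) = cmod (w - z).
Proof. by rewrite -cmodN opprB. Qed.

Lemma cmod_eq0 z : (cmod z == 0) = (z == 0).
Proof. by rewrite -(normr_eq0 z) normcE_cmod -(inj_eq (@complexI R)). Qed.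

Lemma cmod_gt0 z : (0 < cmod z) = (z != 0).
Proof. by rewrite lt_def cmod_ge0 andbT cmod_eq0. Qed.

Lemma cmod_lt_sqr (z w : C) : (cmod z < cmod w) = (cmod z ^+ 2 < cmod w ^+ 2).
Proof. by rewrite ltr_pXn2r // nnegrE cmod_ge0. Qed.

Lemma cmod_nat n : cmod n%:R = n%:R.
Proof. by rewrite /cmod normr_nat -(rmorph_nat (real_complex R)). Qed.

Lemma cmod_real (t : R) : cmod (t%:C)%C = `|t|.
Proof. by rewrite cmodE /= expr0n addr0 sqrtr_sqr. Qed.

Lemma cmod_sum (I : Type) (r : seq I) (P : pred I) (u : I -> C) :
  cmod (\sum_(i <- r | P i) u i) <= \sum_(i <- r | P i) cmod (u i).
Proof.
elim/big_ind2: _ => [|z1 t1 z2 t2 h1 h2|//]; first by rewrite cmod0.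
by rewrite (le_trans (cmodD _ _)) // lerD.
Qed.

Lemma normRe_cmod z : `|Re z| <= cmod z.
Proof. by rewrite -lecR -normcE_cmod normc_ge_Re. Qed.

Lemma normIm_cmod z : `|Im z| <= cmod z.
Proof. by rewrite cmodE -sqrtr_sqr ler_wsqrtr // lerDr sqr_ge0. Qed.

Lemma cmod_le_ReIm z : cmod z <= `|Re z| + `|Im z|.
Proof.
rewrite -(@ler_pXn2r _ 2) // ?nnegrE ?cmod_ge0 ?addr_ge0 //.
rewrite sqr_cmod sqrrD !real_normK ?num_real //.
by rewrite -addrA [X in _ <= _ + X]addrC addrA lerDl mulrn_wge0 ?mulr_ge0.
Qed.

Lemma cReD z w : Re (z + w) = Re z + Re w. Proof. by case: z; case: w. Qed.
Lemma cImD z w : Im (z + w) = Im z + Im w. Proof. by case: z; case: w. Qed.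
Lemma cReN z : Re (- z) = - Re z. Proof. by case: z. Qed.
Lemma cImN z : Im (- z) = - Im z. Proof. by case: z. Qed.
Lemma cReM z w : Re (z * w) = Re z * Re w - Im z * Im w.
Proof. by case: z; case: w. Qed.
Lemma cImM z w : Im (z * w) = Re z * Im w + Im z * Re w.
Proof. by case: z; case: w => a b c d /=; rewrite addrC [RHS]addrC addrC. Qed.
Lemma cReJ z : Re (z^*) = Re z. Proof. by case: z. Qed.
Lemma cImJ z : Im (z^*) = - Im z. Proof. by case: z. Qed.

Lemma complex_ext z w : Re z = Re w -> Im z = Im w -> z = w.
Proof. by case: z; case: w => a b c d /= -> ->. Qed.

Lemma Re_realM (t : R) z : Re ((t%:C)%C * z) = t * Re z.
Proof. by rewrite cReM /= mul0r subr0. Qed.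

Lemma Im_realM (t : R) z : Im ((t%:C)%C * z) = t * Im z.
Proof. by rewrite cImM /= mul0r addr0. Qed.

Lemma cmodJ z : cmod (z^*) = cmod z.
Proof. by rewrite !cmodE cReJ cImJ sqrrN. Qed.

Lemma mulcJ z : z * z^* = ((cmod z ^+ 2)%:C)%C.
Proof.
apply: complex_ext; rewrite ?cReM ?cImM cReJ cImJ /= ?sqr_cmod; ring.
Qed.

Lemma unimod_mulJ x : cmod x = 1 -> x * x^* = 1.
Proof. by move=> x1; rewrite mulcJ x1 expr1n. Qed.

Lemma unimod_neq0 x : cmod x = 1 -> x != 0.
Proof. by move=> x1; rewrite -cmod_eq0 x1 oner_eq0. Qed.

Lemma unit_diskE z : unit_disk z = (cmod z < 1) :> Prop.
Proof.
by rewrite /unit_disk /= normcE_cmod -(rmorph1 (real_complex R)) ltcR.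
Qed.

Lemma cvgc_cmod T (F : set_system T) {FF : Filter F} (f : T -> C) (l : C) :
  (f x @[x --> F] --> l) <->
  (forall e : R, 0 < e -> \forall x \near F, cmod (l - f x) < e).
Proof.
split=> [/cvgrPdist_lt H e e0|H].
  have /H : 0 < (e%:C)%C :> C by rewrite ltcR.
  by apply: filterS => x; rewrite normcE_cmod ltcR.
apply/cvgrPdist_lt => e e0; have eE : e = ((Re e)%:C)%C.
  by rewrite RRe_real // gtr0_real.
have /H : 0 < Re e by move: e0; rewrite eE ltcR.
by apply: filterS => x; rewrite eE normcE_cmod ltcR.
Qed.

Lemma cvgc_ReIm T (F : set_system T) {FF : Filter F} (f : T -> C) (a b : R) :
  Re (f x) @[x --> F] --> a -> Im (f x) @[x --> F] --> b ->
  f x @[x --> F] --> ((a +i* b)%C : C).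
Proof.
move=> /cvgrPdist_lt Ha /cvgrPdist_lt Hb; apply/cvgc_cmod => e e0.
have e2 : 0 < e / 2 by rewrite divr_gt0.
near=> x; apply: le_lt_trans (cmod_le_ReIm _) _.
rewrite cReD cImD cReN cImN /= (splitr e) ltrD //.
  by near: x; exact: Ha.
by near: x; exact: Hb.
Unshelve. all: by end_near. Qed.

Lemma cvg_Rec T (F : set_system T) {FF : Filter F} (f : T -> C) (l : C) :
  f x @[x --> F] --> l -> Re (f x) @[x --> F] --> Re l.
Proof.
move=> /cvgc_cmod H; apply/cvgrPdist_lt => e /H; apply: filterS => x.
by apply: le_lt_trans; rewrite -cReN -cReD normRe_cmod.
Qed.

Lemma cvg_Imc T (F : set_system T) {FF : Filter F} (f : T -> C) (l : C) :
  f x @[x --> F] --> l -> Im (f x) @[x --> F] --> Im l.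
Proof.
move=> /cvgc_cmod H; apply/cvgrPdist_lt => e /H; apply: filterS => x.
by apply: le_lt_trans; rewrite -cImN -cImD normIm_cmod.
Qed.

Lemma cvg_cmod_le (u : nat -> C) (l : C) (K : R) :
  (u n @[n --> \oo] --> l) -> (forall n, cmod (u n) <= K) -> cmod l <= K.
Proof.
move=> /cvgc_cmod ul uK; apply/ler_addgt0Pr => e /ul.
case=> N _ /(_ N) /= /(_ (leqnn _)) H.
have -> : l = u N + (l - u N) by ring.
rewrite (le_trans (cmodD _ _)) // lerD //; exact: ltW.
Qed.

(** Completeness of the complex plane, in the form needed for power series: the
    real and imaginary parts converge absolutely in R. *)
Lemma cvg_series_cmod_bounded (u : nat -> C) (B : R) :
  (forall n, \sum_(i < n) cmod (u i) <= B) -> cvgn (series u).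
Proof.
move=> uB.
have key (v : nat -> R) : (forall i, `|v i| <= cmod (u i)) -> cvgn (series v).
  move=> vu; apply: normed_cvg; apply: nondecreasing_is_cvgn.
    apply/nondecreasing_seqP => n.
    rewrite [leRHS]/normed_series_of [leLHS]/normed_series_of /series /=.
    by rewrite big_nat_recr //= lerDl.
  exists B => _ [n _ <-]; apply: le_trans (uB n).
  by rewrite /normed_series_of /series /= big_mkord ler_sum.
have sRe n : Re (series u n) = series (fun i => Re (u i)) n.
  rewrite /series /=; elim: n => [|n IH]; first by rewrite !big_geq.
  by rewrite !big_nat_recr //= cReD IH.
have sIm n : Im (series u n) = series (fun i => Im (u i)) n.
  rewrite /series /=; elim: n => [|n IH]; first by rewrite !big_geq.
  by rewrite !big_nat_recr //= cImD IH.
have /cvg_ex [a Ha] := key (fun i => Re (u i)) (fun i => normRe_cmod _).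
have /cvg_ex [b Hb] := key (fun i => Im (u i)) (fun i => normIm_cmod _).
apply/cvg_ex; exists ((a +i* b)%C : C); apply: cvgc_ReIm.
  by under eq_fun do rewrite sRe.
by under eq_fun do rewrite sIm.
Qed.

Lemma cvg_series_term_bounded (u : nat -> C) (l : C) :
  (series u n @[n --> \oo] --> l) ->
  exists2 M : R, 0 <= M & forall n, cmod (u n) <= M.
Proof.
move=> /cvgc_cmod /(_ 1 ltr01) [N _ HN].
have S0 : 0 <= \sum_(i < N) cmod (u i) by apply: sumr_ge0 => i _; exact: cmod_ge0.
exists (\sum_(i < N) cmod (u i) + 2) => [|n]; first by rewrite addr_ge0.
have [nN|Nn] := ltnP n N.
  rewrite (bigD1 (Ordinal nN)) //= -addrA lerDl addr_ge0 //.
  by apply: sumr_ge0 => i _; exact: cmod_ge0.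
have -> : u n = (l - series u n) - (l - series u n.+1).
  by rewrite /series /= big_nat_recr //=; ring.
rewrite (le_trans (cmodD _ _)) // cmodN.
have /= h1 := HN n Nn; have /= h2 := HN n.+1 (leqW Nn).
by lra.
Qed.

Lemma nonzero_1B z : cmod z < 1 -> 1 - z != 0.
Proof.
by move=> z1; apply/eqP => /subr0_eq h; move: z1; rewrite -h cmod1 ltxx.
Qed.

Lemma nonzero_1D w : cmod w < 1 -> 1 + w != 0.
Proof. by rewrite -cmodN => /nonzero_1B; rewrite opprK. Qed.

(** The map 1/(1+w) sends the unit disk into the half-plane Re > 1/2. Both the
    parametrisation of the disk by a half-plane and the lower bound for the
    derivative of the shear come down to this. *)
Lemma Re_inv1D w : cmod w < 1 -> 2^-1 < Re (1 + w)^-1.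
Proof.
move=> w1; have n0 : 0 < cmod (1 + w) ^+ 2.
  by rewrite exprn_gt0 // cmod_gt0 nonzero_1D.
have -> : Re (1 + w)^-1 = Re (1 + w) / cmod (1 + w) ^+ 2.
  by rewrite sqr_cmod; case: (1 + w) => a b.
rewrite ltr_pdivlMr // sqr_cmod cReD cImD /= add0r.
have : cmod w ^+ 2 < 1 by rewrite expr_lt1 ?cmod_ge0.
rewrite sqr_cmod; lra.
Qed.

End ComplexModulus.

(** * Complex derivatives *)

Section DerivationRules.
Variable K : numFieldType.
Implicit Types (F G : K -> K) (z D E k : K).

Lemma cderiv_add F G z D E : is_derive z 1 F D -> is_derive z 1 G E ->
  is_derive z 1 (fun z => F z + G z) (D + E).
Proof. by move=> FD GE; exact: is_deriveD. Qed.

Lemma cderiv_mul F G z D E : is_derive z 1 F D -> is_derive z 1 G E ->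
  is_derive z 1 (fun z => F z * G z) (F z * E + G z * D).
Proof. by move=> FD GE; exact: is_deriveM. Qed.

Lemma cderiv_scale k F z D : is_derive z 1 F D ->
  is_derive z 1 (fun z => k * F z) (k * D).
Proof. by move=> FD; exact: is_deriveZ. Qed.

Lemma cderiv_exp (n : nat) z :
  is_derive z 1 (fun z : K => z ^+ n) (n%:R * z ^+ n.-1).
Proof.
have := is_deriveX n (is_derive_id z 1); rewrite exprfctE => h.
by apply: (is_derive_eq h); rewrite /GRing.scale /= mulr1.
Qed.

Lemma cderiv_comp F G z D E :
  is_derive (G z) 1 F D -> is_derive z 1 G E ->
  is_derive z 1 (F \o G) (D * E).
Proof.
move=> FD GE; have [dF DF] := FD; have [dG DG] := GE.
have dF' : differentiable F (G z) := iffLR (derivable1_diffP _ _) dF.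
have dG' : differentiable G z := iffLR (derivable1_diffP _ _) dG.
have dFG := differentiable_comp dG' dF'.
split; first exact: (iffRL (derivable1_diffP _ _) dFG).
rewrite (deriveE _ dFG).
rewrite (diff_comp dG' dF').
rewrite [LHS]/=.
have h1 : 'd G z (1:K) = E := etrans (esym (deriveE _ dG')) DG.
have h2 : 'd F (G z) (1:K) = D := etrans (esym (deriveE _ dF')) DF.
rewrite [X in 'd F (G z) X]h1.
have -> : E = E *: (1 : K) by rewrite /GRing.scale /= mulr1.
rewrite linearZ.
rewrite h2.
by rewrite /GRing.scale /= mulr1 mulrC.
Qed.

End DerivationRules.

Section ComplexDerivatives.
Variable R : realType.
Local Notation C := (Cplx R).
Local Notation Re := (@complex.Re R).
Local Notation Im := (@complex.Im R).
Implicit Types (F G : C -> C) (z w x D : C).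

Lemma is_derive_derive1 F z (D : C) : is_derive z 1 F D -> F^`() z = D.
Proof. by move=> H; rewrite derive1E derive_val. Qed.

Lemma is_derive_cmodP F z (D : C) : is_derive z 1 F D ->
  forall e : R, 0 < e -> exists2 d : R, 0 < d & forall w, cmod (w - z) < d ->
    cmod (F w - F z - D * (w - z)) <= e * cmod (w - z).
Proof.
case=> dF DF e e0.
have H : (fun h : C => h^-1 *: ((F \o shift z) (h *: 1) - F z)) @ 0^' --> D.
  by rewrite -DF; exact: dF.
have /cvgc_cmod /(_ e e0) := H; rewrite near_withinE => -[d /= d0 Hd].
have dE : d = ((Re d)%:C)%C by rewrite RRe_real // gtr0_real.
exists (Re d) => [|w wz]; first by move: d0; rewrite dE ltcR.
have [->|wz0] := eqVneq w z; first by rewrite !subrr mulr0 subr0 cmod0 mulr0.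
have w0 : w - z != 0 by rewrite subr_eq0.
have := Hd (w - z) _ w0.
rewrite /ball_ /= sub0r normrN normcE_cmod dE ltcR => /(_ wz).
rewrite /GRing.scale /= mulr1 subrK => h.
have -> : F w - F z - D * (w - z) = - (D - (w - z)^-1 * (F w - F z)) * (w - z).
  by field.
by rewrite cmodM cmodN ler_wpM2r ?cmod_ge0 // ltW.
Qed.

Lemma quadratic_is_derive F z (D : C) (K d : R) : 0 < d ->
  (forall w, cmod (w - z) < d ->
     cmod (F w - F z - D * (w - z)) <= K * cmod (w - z) ^+ 2) ->
  is_derive z 1 F D.
Proof.
move=> d0 H.
suff h : (fun h : C => h^-1 *: ((F \o shift z) (h *: 1) - F z)) @ 0^' --> D.
  by apply: DeriveDef; [apply/cvg_ex; exists D | rewrite /derive; apply: cvg_lim].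
apply/cvgc_cmod => e e0.
have K1 : 0 < `|K| + 1 by rewrite ltr_wpDl.
have m0 : 0 < Num.min d (e / (`|K| + 1)) by rewrite lt_min d0 divr_gt0.
exists ((Num.min d (e / (`|K| + 1)))%:C)%C => /=; first by rewrite ltcR.
move=> h /=; rewrite sub0r normrN normcE_cmod ltcR lt_min => /andP[hd he] h0.
have hE : h *: 1 + z - z = h by rewrite addrK /GRing.scale /= mulr1.
have := H (h *: 1 + z); rewrite hE => /(_ hd) => {}H.
have -> : D - h^-1 *: (F (h *: 1 + z) - F z) =
          - (h^-1 * (F (h *: 1 + z) - F z - D * h)).
  by rewrite /GRing.scale /=; field.
rewrite cmodN cmodM cmodV mulrC ltr_pdivrMr ?cmod_gt0 //.
apply: le_lt_trans H _; rewrite expr2 mulrA ltr_pM2r ?cmod_gt0 //.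
apply: le_lt_trans (_ : (`|K| + 1) * cmod h < _).
  by rewrite ler_wpM2r ?cmod_ge0 // (le_trans (ler_norm _)) // lerDl.
by rewrite mulrC -ltr_pdivlMr.
Qed.

Lemma near_disk z : cmod z < 1 -> \forall w \near z, cmod w < 1.
Proof.
move=> z1; have d0 : 0 < 1 - cmod z by rewrite subr_gt0.
exists (((1 - cmod z)%:C)%C) => /=; first by rewrite ltcR.
move=> w; rewrite /ball_ /= normcE_cmod ltcR cmodB => wz.
have -> : w = (w - z) + z by ring.
by apply: le_lt_trans (cmodD _ _) _; rewrite -ltrBrDr.
Qed.

Lemma derive1_eq_disk F G z : (forall w, cmod w < 1 -> F w = G w) ->
  cmod z < 1 -> derive1 F z = derive1 G z.
Proof.
move=> FG z1; rewrite !derive1E; apply: near_eq_derive.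
by apply: filterS (near_disk z1) => w /FG.
Qed.

Lemma is_derive_inv1B (x z : C) k : 1 - x * z != 0 ->
  is_derive z 1 (fun z => (1 - x * z)^-1 ^+ k) (k%:R * x * (1 - x * z)^-1 ^+ k.+1).
Proof.
move=> nz.
pose f := fun z : C => 1 - x * z.
have df : is_derive z 1 (fun z : C => 1 - x * z) (- x).
  apply: is_derive_eq. rewrite /GRing.scale /=. by rewrite mulr1 sub0r.
have dfV : is_derive z 1 (fun z => (f z)^-1) (x * (1 - x * z)^-1 ^+ 2).
  have [dbl Df] := df; split; first exact: derivableV.
  by rewrite deriveV // Df /GRing.scale /= /f; field.
case: k => [|k]; first by rewrite !mul0r; exact: is_derive_cst.
have := is_deriveX k.+1 dfV.
rewrite exprfctE => h; apply: (is_derive_eq h).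
by rewrite /GRing.scale /= /f !exprS; ring.
Qed.

End ComplexDerivatives.

(** * Power series in the unit disk *)

Section PowerSeries.
Variable R : realType.
Local Notation C := (Cplx R).
Local Notation Re := (@complex.Re R).
Local Notation Im := (@complex.Im R).
Implicit Types (a b : nat -> C) (F G h H : C -> C) (z w x : C).

Lemma sum_quad_geom (q : R) n : 0 <= q < 1 ->
  \sum_(i < n) (i.+1 * i.+2)%:R * q ^+ i <= 2 / (1 - q) ^+ 3.
Proof.
move=> /andP[q0 q1]; have p0 : 0 < 1 - q by rewrite subr_gt0.
pose A := (1 - q)^-1; have A0 : 0 <= A by rewrite invr_ge0 ltW.
(* g solves g i - q * g i.+1 = (i+1)(i+2), so the sum telescopes. *)
pose g i : R := A * (i.+1 * i.+2)%:R + 2 * q * A ^+ 2 * i.+2%:R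
  + 2 * q ^+ 2 * A ^+ 3.
have g0 i : 0 <= g i.
  by rewrite /g !addr_ge0 // !mulr_ge0 // exprn_ge0.
suff H : \sum_(i < n) (i.+1 * i.+2)%:R * q ^+ i = g 0 - q ^+ n * g n.
  rewrite H (_ : 2 / (1 - q) ^+ 3 = g 0).
    by rewrite lerBlDr lerDl mulr_ge0 // exprn_ge0.
  by rewrite /g /A; field; rewrite gt_eqF.
elim: n => [|n IH]; first by rewrite big_ord0 expr0 mul1r subrr.
rewrite big_ord_recr /= IH exprS -[LHS]addrA; congr (_ + _).
rewrite /g /A !natrM -!(natr1 n.+2) -!(natr1 n.+1) -!(natr1 n).
by field; rewrite gt_eqF.
Qed.

(** Second-order Taylor estimate for a power, uniform on the disk of radius rho.
    The factor rho^2 on the left avoids the exponent n - 2. *)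
Lemma expr_taylor_bound (rho : R) z w n : cmod z <= rho -> cmod w <= rho ->
  cmod (w ^+ n - z ^+ n - n%:R * z ^+ n.-1 * (w - z)) * rho ^+ 2
    <= (n ^ 2)%:R * rho ^+ n * cmod (w - z) ^+ 2.
Proof.
move=> zr wr; have r0 : 0 <= rho := le_trans (cmod_ge0 _) zr.
elim: n => [|n IH]; first by rewrite subrr mul0r mul0r subr0 cmod0 !mul0r.
have -> : w ^+ n.+1 - z ^+ n.+1 - n.+1%:R * z ^+ n.+1.-1 * (w - z) =
   w * (w ^+ n - z ^+ n - n%:R * z ^+ n.-1 * (w - z))
   + n%:R * z ^+ n.-1 * (w - z) ^+ 2.
  case: n {IH} => [|n] /=; first by rewrite !expr1 !expr0; ring.
  by rewrite !exprS -(natr1 n.+1); ring.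
apply: le_trans (ler_wpM2r (sqr_ge0 _) (cmodD _ _)) _.
rewrite mulrDl cmodM (cmodM _ (_ ^+ 2)) (cmodM n%:R) !cmodX cmod_nat.
set E := cmod (w ^+ n - _ - _) in IH *; set d := cmod (w - z).
have d0 : 0 <= d := cmod_ge0 _.
have h1 : cmod w * E * rho ^+ 2 <= rho * ((n ^ 2)%:R * rho ^+ n * d ^+ 2).
  by rewrite -mulrA ler_pM // ?mulr_ge0 ?sqr_ge0 ?cmod_ge0.
have h2 : n%:R * cmod z ^+ n.-1 * d ^+ 2 * rho ^+ 2
          <= n%:R * rho ^+ n.+1 * d ^+ 2.
  case: n {IH E h1} => [|n] /=; first by rewrite !mul0r.
  rewrite mulrAC ler_wpM2r ?sqr_ge0 // -mulrA ler_wpM2l //.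
  rewrite -(addn2 n) exprD ler_wpM2r ?sqr_ge0 //.
  by rewrite lerXn2r // nnegrE cmod_ge0.
apply: le_trans (lerD h1 h2) _.
have -> : rho * ((n ^ 2)%:R * rho ^+ n * d ^+ 2)
    = (n ^ 2)%:R * rho ^+ n.+1 * d ^+ 2 by rewrite (exprS rho); ring.
rewrite -!mulrDl.
rewrite ler_wpM2r ?sqr_ge0 // ler_wpM2r ?exprn_ge0 //.
by rewrite -natrD ler_nat; nia.
Qed.

Definition pow_series a F :=
  forall z, cmod z < 1 -> series (fun n => a n * z ^+ n) n @[n --> \oo] --> F z.

Definition dcoef a : nat -> C := fun n => n.+1%:R * a n.+1.

Lemma pow_series_coef_bound a F (r : R) : pow_series a F -> 0 <= r < 1 ->
  exists2 M : R, 0 <= M & forall n, cmod (a n) * r ^+ n <= M.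
Proof.
move=> H /andP[r0 r1].
have /H : cmod ((r%:C)%C : C) < 1 by rewrite cmod_real ger0_norm.
case/cvg_series_term_bounded => M M0 HM; exists M => // n.
by have := HM n; rewrite cmodM cmodX cmod_real ger0_norm.
Qed.

(** Termwise differentiation. Summing the second-order Taylor estimates of the
    powers against geometrically decreasing coefficients shows that F differs
    from its candidate linearisation by O(|w - z|^2). *)
Theorem pow_series_derive a F : pow_series a F -> forall z, cmod z < 1 ->
  exists2 D, series (fun n => dcoef a n * z ^+ n) n @[n --> \oo] --> D &
    is_derive z 1 F D.
Proof.
move=> HF z z1.
(* |z| < rho < r < 1: nearby points w stay in the disk of radius rho, while the
   coefficients are controlled by r, so that (rho / r)^n beats n^2. *)
pose rho := (2 * cmod z + 1) / 3; pose r := (cmod z + 2) / 3.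
have z0 := cmod_ge0 z.
have r0 : 0 < r by rewrite /r; lra.
have rho0 : 0 < rho by rewrite /rho; lra.
have rhor : rho < r by rewrite /rho /r; lra.
have r1 : r < 1 by rewrite /r; lra.
have zrho : cmod z < rho by rewrite /rho; lra.
clearbody rho r.
have [M M0 HM] : exists2 M : R, 0 <= M & forall n, cmod (a n) * r ^+ n <= M.
  by apply: pow_series_coef_bound HF _; rewrite ltW.
pose q := rho / r.
have q01 : 0 <= q < 1 by rewrite divr_ge0 ?ltW //= ltr_pdivrMr ?mul1r.
have aq n : cmod (a n) * rho ^+ n <= M * q ^+ n.
  rewrite /q exprMn mulrA exprVn ler_pdivlMr ?exprn_gt0 //.
  by rewrite mulrAC ler_wpM2r // exprn_ge0 // ltW.
pose S := 2 / (1 - q) ^+ 3.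
have /cvg_ex[D HD] : cvgn (series (fun n => dcoef a n * z ^+ n)).
  apply: (@cvg_series_cmod_bounded _ _ (M * S / rho)) => n.
  have S1 : \sum_(i < n.+1) (i.+1 * i.+2)%:R * q ^+ i <= S by exact: sum_quad_geom.
  rewrite ler_pdivlMr // mulr_suml.
  apply: le_trans (ler_wpM2l M0 S1); rewrite mulr_sumr big_ord_recl /=.
  apply: ler_wpDl.
    by rewrite !mulr_ge0 // exprn_ge0; case/andP: q01.
  apply: ler_sum => i _; rewrite /dcoef !cmodM cmodX cmod_nat /bump /= add1n.
  rewrite mulrCA; apply: le_trans (_ : i.+1%:R * (M * q ^+ i.+1) <= _).
    rewrite -!mulrA ler_wpM2l // (le_trans _ (aq _)) //.
    rewrite ler_wpM2l ?cmod_ge0 // exprSr ler_wpM2r ?(ltW rho0) //.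
    by rewrite lerXn2r ?nnegrE ?cmod_ge0  ?(ltW rho0) ?(ltW zrho).
  apply: ler_wpM2r; last by rewrite ler_nat (leq_trans (leqnSn _)) // leq_pmulr.
  by rewrite mulr_ge0 // exprn_ge0 // divr_ge0 // ltW.
exists D; first exact: HD.
apply: (@quadratic_is_derive _ _ _ _ (M * S / rho ^+ 2) (rho - cmod z)).
  by rewrite subr_gt0.
move=> w wz; have wrho : cmod w <= rho.
  have -> : w = (w - z) + z by ring.
  by apply: le_trans (cmodD _ _) _; lra.
have w1 : cmod w < 1 by lra.
(* Partial sums of F w - F z - D (w - z); the derived series is one index
   behind. *)
pose u n := series (fun n => a n * w ^+ n) n.+1
  - series (fun n => a n * z ^+ n) n.+1
  - series (fun n => dcoef a n * z ^+ n) n * (w - z).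
have uE n : u n =
    \sum_(i < n.+1) a i * (w ^+ i - z ^+ i - i%:R * z ^+ i.-1 * (w - z)).
  rewrite /u /series /= !big_mkord.
  elim: n => [|n IH].
    by rewrite !big_ord_recr !big_ord0 /=; ring.
  rewrite big_ord_recr /= [in X in _ - X - _]big_ord_recr /=.
  rewrite [in X in _ - _ - X]big_ord_recr /=.
  rewrite [RHS]big_ord_recr -IH /= /dcoef; ring.
apply: (@cvg_cmod_le _ u).
  apply: cvgB; last by apply: cvgM; [exact: HD | exact: cvg_cst].
  apply: cvgB.
    by have := HF w w1; rewrite -cvg_shiftS; exact.
  by have := HF z z1; rewrite -cvg_shiftS; exact.
move=> n; rewrite uE; apply: (le_trans (cmod_sum _ _ _)).
have S1 : \sum_(i < n.+1) (i.+1 * i.+2)%:R * q ^+ i <= S by exact: sum_quad_geom.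
rewrite mulrAC ler_pdivlMr ?exprn_gt0 //.
apply: le_trans (ler_wpM2r (sqr_ge0 (cmod (w - z))) (ler_wpM2l M0 S1)).
rewrite mulr_sumr !mulr_suml; apply: ler_sum => i _.
rewrite cmodM -[leLHS]mulrA.
apply: le_trans (ler_wpM2l (cmod_ge0 _) (expr_taylor_bound i (ltW zrho) wrho)) _.
rewrite mulrA ler_wpM2r ?sqr_ge0 // mulrCA [leRHS]mulrCA.
apply: le_trans (ler_wpM2l _ (aq i)) _ => //.
apply: ler_wpM2r; last by rewrite ler_nat -mulnn leq_mul // ltnW.
by rewrite mulr_ge0 // exprn_ge0 // divr_ge0 // ltW.
Qed.

Lemma pow_series_is_derive a F z : pow_series a F -> cmod z < 1 ->
  is_derive z 1 F (derive1 F z).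
Proof.
move=> H z1; have [D _ dF] := pow_series_derive H z1.
by rewrite (is_derive_derive1 dF).
Qed.

Lemma pow_series_derive1 a F : pow_series a F -> pow_series (dcoef a) (derive1 F).
Proof.
move=> H z z1; have [D HD dF] := pow_series_derive H z1.
by rewrite (is_derive_derive1 dF).
Qed.

Lemma pow_series_eq a b F G : (forall n, a n = b n) ->
  (forall z, cmod z < 1 -> F z = G z) -> pow_series a F -> pow_series b G.
Proof. by move=> /funext -> FG H z z1; rewrite -FG //; exact: H. Qed.

Lemma pow_series_unique a F G : pow_series a F -> pow_series a G ->
  forall z, cmod z < 1 -> F z = G z.
Proof.
move=> HF HG z z1.
rewrite -(cvg_lim (@norm_hausdorff _ _) (HF z z1)).
by rewrite (cvg_lim (@norm_hausdorff _ _) (HG z z1)).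
Qed.

Lemma pow_seriesD a b F G : pow_series a F -> pow_series b G ->
  pow_series (fun n => a n + b n) (fun z => F z + G z).
Proof.
move=> HF HG z z1.
have -> : series (fun n => (a n + b n) * z ^+ n) =
    series (fun n => a n * z ^+ n) + series (fun n => b n * z ^+ n).
  rewrite funeqE => n; rewrite /series /= /GRing.add /= -big_split /=.
  by apply: eq_bigr => i _; rewrite mulrDl.
by apply: cvgD; [exact: HF | exact: HG].
Qed.

Lemma pow_seriesZ (k : C) a F : pow_series a F ->
  pow_series (fun n => k * a n) (fun z => k * F z).
Proof.
move=> HF z z1.
have -> : series (fun n => (k * a n) * z ^+ n) =
    (fun n => k * series (fun n => a n * z ^+ n) n).
  rewrite funeqE => n; rewrite /series /= mulr_sumr.
  by apply: eq_bigr => i _; rewrite mulrA.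
by apply: cvgM; [exact: cvg_cst | exact: HF].
Qed.

Lemma pow_series_mulX a F : pow_series a F ->
  pow_series (fun n => if n is k.+1 then a k else 0) (fun z => z * F z).
Proof.
move=> HF z z1; rewrite -cvg_shiftS.
have -> : (fun n => series (fun n => (if n is k.+1 then a k else 0) * z ^+ n) n.+1)
   = (fun n => z * series (fun n => a n * z ^+ n) n).
  rewrite funeqE => n; rewrite /series /= big_nat_recl //= mul0r add0r mulr_sumr.
  by apply: eq_bigr => i _; rewrite exprS mulrCA.
by apply: cvgM; [exact: cvg_cst | exact: HF].
Qed.

Lemma pow_series_cst (k : C) :
  pow_series (fun n => if n is 0 then k else 0) (fun=> k).
Proof.
move=> z z1; rewrite -cvg_shiftS (_ : (fun n => _) = cst k).
  exact: cvg_cst.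
rewrite funeqE => n; rewrite /series /= big_nat_recl //= expr0 mulr1.
by rewrite big1 ?addr0 // => i _; rewrite mul0r.
Qed.

Lemma pow_series_geom : pow_series (fun=> 1) (fun z : C => (1 - z)^-1).
Proof.
move=> z z1; have nz := nonzero_1B z1.
have sE n : series (fun n => 1 * z ^+ n) n = (1 - z)^-1 - (1 - z)^-1 * z ^+ n.
  rewrite /series /=; elim: n => [|n IH]; first by rewrite big_geq // mulr1 subrr.
  by rewrite big_nat_recr //= IH exprSr; field.
suff : (fun n => (1 - z)^-1 - (1 - z)^-1 * z ^+ n) @ \oo
    --> (1 - z)^-1 - (1 - z)^-1 * 0.
  by rewrite mulr0 subr0; under eq_fun do rewrite -sE.
apply: cvgB; first exact: cvg_cst.
apply: cvgM; first exact: cvg_cst.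
apply/cvgc_cmod => e e0.
have /cvg_expr : `|cmod z| < 1 by rewrite ger0_norm ?cmod_ge0.
move=> /cvgrPdist_lt /(_ e e0); apply: filterS => n.
by rewrite !sub0r normrN cmodN cmodX ger0_norm // exprn_ge0 // cmod_ge0.
Qed.

Lemma pow_series_geom_scaled x : cmod x = 1 ->
  pow_series (fun n => x ^+ n) (fun z => (1 - x * z)^-1).
Proof.
move=> x1 z z1; have xz1 : cmod (x * z) < 1 by rewrite cmodM x1 mul1r.
have -> : (fun n => x ^+ n * z ^+ n) = (fun n => 1 * (x * z) ^+ n).
  by apply/funext => n; rewrite mul1r exprMn.
exact: (@pow_series_geom (x * z) xz1).
Qed.

Lemma pow_series0 a F : pow_series a F -> F 0 = a 0.
Proof.
move=> /(_ 0); rewrite cmod0 => /(_ ltr01) H.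
suff h : series (fun n => a n * 0 ^+ n) n @[n --> \oo] --> a 0.
  by rewrite -(cvg_lim (@norm_hausdorff _ _) H) -(cvg_lim (@norm_hausdorff _ _) h).
rewrite -cvg_shiftS (_ : (fun n => _) = cst (a 0)).
  exact: cvg_cst.
rewrite funeqE => n; rewrite /series /= big_nat_recl //= expr0 mulr1.
by rewrite big1 ?addr0 // => i _; rewrite exprS mul0r mulr0.
Qed.

Lemma iter_dcoef n a k : iter n dcoef a k * k`!%:R = (k + n)`!%:R * a (k + n)%N.
Proof.
elim: n k => [|n IH] k; first by rewrite addn0 mulrC.
rewrite iterS /dcoef mulrAC -natrM -factS mulrC IH addSnnS //.
Qed.

Lemma pow_series_taylor_coef a F n : pow_series a F -> taylor_coef F n = a n.
Proof.
move=> H; rewrite /taylor_coef.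
have HS : pow_series (iter n dcoef a) (derive1n n F).
  by elim: n => [|n IH]; [exact: H | exact: pow_series_derive1 IH].
rewrite (pow_series0 HS).
have := iter_dcoef n a 0; rewrite fact0 mulr1 add0n => ->.
by rewrite mulrC mulKf // pnatr_eq0 -lt0n fact_gt0.
Qed.

Lemma has_taylor_pow_series F :
  has_taylor_expansion F -> pow_series (taylor_coef F) F.
Proof. by move=> H z z1; apply: H; rewrite unit_diskE. Qed.

Lemma pow_series_analytic a F : pow_series a F -> analytic_on_disk F.
Proof.
by move=> H z; rewrite unit_diskE => z1; have [] := pow_series_is_derive H z1.
Qed.

Lemma pow_series_taylor a F : pow_series a F -> has_taylor_expansion F.
Proof.
move=> H z; rewrite unit_diskE => z1.
have -> : taylor_coef F = a.
  by apply/funext => n; exact: pow_series_taylor_coef H.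
exact: H.
Qed.

Lemma pow_series_unif a F (r e : R) : pow_series a F -> 0 <= r < 1 -> 0 < e ->
  exists M : nat, forall m z, (M <= m)%N -> cmod z <= r ->
    cmod (F z - \sum_(i < m) a i * z ^+ i) <= e.
Proof.
move=> H /andP[r0 r1] e0; pose s := (1 + r) / 2.
have s1 : 0 < s < 1 by rewrite /s; lra.
have rs : r < s by rewrite /s; lra.
clearbody s; case/andP: s1 => s0 s1.
have [B B0 HB] : exists2 B : R, 0 <= B & forall n, cmod (a n) * s ^+ n <= B.
  by apply: pow_series_coef_bound H _; rewrite ltW.
pose q := r / s.
have q0 : 0 <= q by rewrite divr_ge0 // ltW.
have q1 : q < 1 by rewrite ltr_pdivrMr ?mul1r.
have p0 : 0 < 1 - q by rewrite subr_gt0.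
have aq i z : cmod z <= r -> cmod (a i * z ^+ i) <= B * q ^+ i.
  move=> zr; rewrite cmodM cmodX.
  apply: le_trans (_ : cmod (a i) * r ^+ i <= _).
    by rewrite ler_wpM2l ?cmod_ge0 // lerXn2r // nnegrE cmod_ge0.
  rewrite [q ^+ i]exprMn mulrA exprVn ler_pdivlMr ?exprn_gt0 //.
  by rewrite mulrAC ler_wpM2r // exprn_ge0.
have [M HM] : exists M : nat, forall m, (M <= m)%N -> B * q ^+ m / (1 - q) <= e.
  have /cvg_expr : `|q| < 1 by rewrite ger0_norm.
  have c0 : 0 < e * (1 - q) / (B + 1) by rewrite divr_gt0 ?mulr_gt0 // ltr_wpDl.
  move=> /cvgrPdist_lt /(_ _ c0) [M _ HM].
  exists M => m /HM /=; rewrite sub0r normrN ger0_norm ?exprn_ge0 // => hM.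
  rewrite ler_pdivrMr //; move: hM; rewrite ltr_pdivlMr ?ltr_wpDl // => hM.
  apply: le_trans (ltW hM); rewrite mulrC ler_wpM2l ?exprn_ge0 //; lra.
exists M => m z /HM {}HM zr.
have z1 : cmod z < 1 by exact: le_lt_trans zr r1.
have geo n : \sum_(i < n) q ^+ i <= (1 - q)^-1.
  suff -> : \sum_(i < n) q ^+ i = (1 - q ^+ n) / (1 - q).
    by rewrite ler_pdivrMr // mulVf ?gt_eqF // gerBl exprn_ge0.
  elim: n => [|n IH]; first by rewrite big_ord0 subrr mul0r.
  by rewrite big_ord_recr /= IH exprSr; field; rewrite gt_eqF.
pose u n := series (fun i => a i * z ^+ i) (n + m)%N - \sum_(i < m) a i * z ^+ i.
apply: (@cvg_cmod_le _ u).
  apply: cvgB; last exact: cvg_cst.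
  by have := H z z1; rewrite -(cvg_shiftn m); exact.
move=> n; apply: le_trans HM.
have -> : u n = \sum_(i < n) a (m + i)%N * z ^+ (m + i).
  rewrite /u /series /= big_mkord addnC big_split_ord /=.
  by rewrite -addrA addrCA subrr addr0.
apply: (le_trans (cmod_sum _ _ _)).
apply: le_trans (_ : \sum_(i < n) B * q ^+ m * q ^+ i <= _).
  by apply: ler_sum => i _; rewrite -mulrA -exprD aq.
by rewrite -mulr_sumr ler_wpM2l // mulr_ge0 // exprn_ge0.
Qed.

Lemma hadamard_pow_series a b h H F : pow_series a h -> pow_series b H ->
  pow_series (fun n => a n * b n) F ->
  forall z, cmod z < 1 -> hadamard h H z = F z.
Proof.
move=> ah bH abF z z1; apply: (cvg_lim (@norm_hausdorff _ _)).
have -> : taylor_coef h = a.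
  by apply/funext => n; exact: pow_series_taylor_coef ah.
have -> : taylor_coef H = b.
  by apply/funext => n; exact: pow_series_taylor_coef bH.
exact: abF.
Qed.

End PowerSeries.

(** * The equality case of the first-coefficient bound in a half-plane *)

Section Caratheodory.
Variable R : realType.
Local Notation C := (Cplx R).
Local Notation Re := (@complex.Re R).
Local Notation Im := (@complex.Im R).
Implicit Types (a : nat -> C) (F : C -> C) (z w x : C).

Lemma expiD (s t : R) : expi (s + t) = expi s * expi t.
Proof.
apply: complex_ext; rewrite ?cReM ?cImM /=; first by rewrite cosD.
by rewrite sinD addrC.
Qed.

Lemma expi0 : expi (0 : R) = 1.
Proof. by apply: complex_ext => /=; rewrite ?cos0 ?sin0. Qed.

Lemma expiMn (t : R) n : expi (n%:R * t) = expi t ^+ n.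
Proof.
elim: n => [|n IH]; first by rewrite mul0r expi0.
by rewrite -natr1 mulrDl mul1r expiD IH exprSr.
Qed.

Lemma cmod_expi (t : R) : cmod (expi t) = 1.
Proof. by rewrite cmodE /= cos2Dsin2 sqrtr1. Qed.

Lemma expi_conj (t : R) : (expi t)^* = expi (- t).
Proof. by apply: complex_ext; rewrite ?cReJ ?cImJ /= ?cosN ?sinN. Qed.

Lemma expi_2pi_neq1 (t : R) : 0 < t < 2 * pi -> expi t != 1.
Proof.
move=> /andP[t0 t1]; apply/eqP => E.
have : sin (t / 2) = 0.
  apply/eqP; rewrite -sqrf_eq0 sin2cos2.
  have := cos_mulr2n (t / 2); rewrite -(mulr_natr (t / 2)) divfK // => h.
  have : cos t = 1 by have := congr1 Re E.
  by rewrite h => h2; apply/eqP; lra.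
by apply/eqP; rewrite gt_eqF // sin_gt0_pi //; lra.
Qed.

Definition unity_root (N : nat) : C := expi (2 * pi / N%:R).

Lemma unity_root_expN N : (0 < N)%N -> unity_root N ^+ N = 1.
Proof.
move=> N0; rewrite -expiMn.
have -> : N%:R * (2 * pi / N%:R) = pi *+ 2 :> R.
  by rewrite -mulr_natr; field; rewrite pnatr_eq0 -lt0n.
by apply: complex_ext; rewrite /= ?cos2pi ?sin2pi.
Qed.

Lemma unity_root_neq1 N m : (0 < m < N)%N -> unity_root N ^+ m != 1.
Proof.
move=> /andP[m0 mN]; rewrite -expiMn; apply: expi_2pi_neq1.
have N0 : 0 < N%:R :> R by rewrite ltr0n (leq_trans _ mN).
have p0 : 0 < 2 * pi :> R by rewrite mulr_gt0 ?pi_gt0.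
apply/andP; split; first by rewrite mulr_gt0 ?ltr0n // divr_gt0.
by rewrite mulrCA gtr_pMr // ltr_pdivrMr // mul1r ltr_nat.
Qed.

Lemma sum_unity_root (q : C) N : q ^+ N = 1 -> q != 1 -> \sum_(j < N) q ^+ j = 0.
Proof.
move=> qN q1; have := subrX1 q N; rewrite qN subrr => /esym /eqP.
by rewrite mulf_eq0 subr_eq0 (negbTE q1) => /eqP.
Qed.

Lemma unity_root_orth N i k : (i < N)%N -> (k < N)%N ->
  \sum_(j < N) (unity_root N ^+ j) ^+ i * ((unity_root N ^+ j)^*) ^+ k
    = if i == k then N%:R else 0.
Proof.
move=> iN kN; set q := unity_root N; have N0 : (0 < N)%N by exact: leq_ltn_trans iN.
have qN : q ^+ N = 1 by exact: unity_root_expN.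
have q1 : cmod q = 1 by exact: cmod_expi.
have qq : q * q^* = 1 by exact: unimod_mulJ.
under eq_bigr => j _.
  rewrite rmorphXn /= -!exprM ![(j * _)%N]mulnC !exprM -exprMn.
  over.
case: eqP => [->|ik].
  under eq_bigr do rewrite -exprMn qq !expr1n.
  by rewrite sumr_const card_ord.
apply: sum_unity_root.
  rewrite exprMn -!exprM ![(_ * N)%N]mulnC !exprM -rmorphXn /= qN.
  by rewrite rmorph1 !expr1n mulr1.
have [lt|gt|//] := ltngtP i k.
  rewrite -(subnKC (ltnW lt)) exprD mulrA -exprMn qq expr1n mul1r.
  rewrite -rmorphXn /=; apply/eqP => /(congr1 Num.conj).
  rewrite conjCK rmorph1 => /eqP; apply/negP/unity_root_neq1.
  by rewrite subn_gt0 lt /= (leq_ltn_trans (leq_subr _ _)).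
rewrite -(subnKC (ltnW gt)) exprD mulrAC -exprMn qq expr1n mul1r.
apply: unity_root_neq1; by rewrite subn_gt0 gt /= (leq_ltn_trans (leq_subr _ _)).
Qed.

Lemma unity_root_orthJ N i k : (0 < i + k < N)%N ->
  \sum_(j < N) ((unity_root N ^+ j)^*) ^+ i * ((unity_root N ^+ j)^*) ^+ k = 0.
Proof.
move=> ikN; set q := unity_root N; have N0 : (0 < N)%N by lia.
have qN : q ^+ N = 1 by exact: unity_root_expN.
under eq_bigr => j _.
  rewrite -exprD rmorphXn /= -!exprM mulnC exprM -rmorphXn /=.
  over.
apply: sum_unity_root.
  by rewrite -rmorphXn -exprM mulnC exprM qN expr1n rmorph1.
apply/eqP => /(congr1 Num.conj); rewrite conjCK rmorph1 => /eqP.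
by apply/negP/unity_root_neq1.
Qed.

Lemma unimod_subX (p x : C) k : cmod p = 1 -> cmod x = 1 ->
  cmod (p ^+ k - x ^+ k) <= k%:R * cmod (p - x).
Proof.
move=> p1 x1; elim: k => [|k IH]; first by rewrite subrr cmod0 mul0r.
have -> : p ^+ k.+1 - x ^+ k.+1 = p * (p ^+ k - x ^+ k) + (p - x) * x ^+ k.
  by rewrite !exprS; ring.
rewrite (le_trans (cmodD _ _)) // !cmodM cmodX x1 p1 expr1n mul1r mulr1.
by rewrite -natr1 mulrDl mul1r lerD2r.
Qed.

(** A positive measure on the unit circle whose first moment is nearly x times its
    total mass is concentrated near x, so each k-th moment is nearly x^k times the
    total mass. The parameter eta weighs the two error terms. *)
Lemma concentrated_moments (I : finType) (wt : I -> R) (p : I -> C) x (eta W : R) k :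
  \sum_j wt j = W -> (forall j, 0 <= wt j) ->
  (forall j, cmod (p j) = 1) -> cmod x = 1 -> 0 < eta ->
  cmod (\sum_j ((wt j)%:C)%C * p j ^+ k - (W%:C)%C * x ^+ k)
  <= W * eta + k%:R ^+ 2 / eta * (2 * (W - Re (x^* * \sum_j ((wt j)%:C)%C * p j))).
Proof.
move=> WE w0 p1 x1 e0.
have -> : \sum_j ((wt j)%:C)%C * p j ^+ k - (W%:C)%C * x ^+ k
   = \sum_j ((wt j)%:C)%C * (p j ^+ k - x ^+ k).
  under [RHS]eq_bigr do rewrite mulrBr.
  by rewrite sumrB -mulr_suml -WE (rmorph_sum (real_complex R)).
have ReS (G : I -> C) : Re (\sum_j G j) = \sum_j Re (G j).
  by elim/big_ind2: _ => // z1 t1 z2 t2 <- <-; rewrite cReD.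
have -> : W - Re (x^* * \sum_j ((wt j)%:C)%C * p j)
   = \sum_j wt j * (1 - Re (x^* * p j)).
  rewrite mulr_sumr ReS -WE -sumrB; apply: eq_bigr => j _.
  by rewrite mulrCA (cReM ((wt j)%:C)%C) /= mul0r subr0; ring.
apply: (le_trans (cmod_sum _ _ _)).
rewrite -WE mulr_suml !mulr_sumr -big_split /=; apply: ler_sum => j _.
rewrite cmodM cmod_real ger0_norm //.
have -> : wt j * eta + k%:R ^+ 2 / eta * (2 * (wt j * (1 - Re (x^* * p j))))
   = wt j * (eta + k%:R ^+ 2 / eta * (2 * (1 - Re (x^* * p j)))) by ring.
apply: ler_wpM2l => //.
apply: le_trans (unimod_subX k (p1 j) x1) _.
have -> : 2 * (1 - Re (x^* * p j)) = cmod (p j - x) ^+ 2.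
  have := congr1 (fun t => t ^+ 2) (p1 j); have := congr1 (fun t => t ^+ 2) x1.
  rewrite !sqr_cmod expr1n cReM cReJ cImJ cReD cImD cReN cImN.
  set a1 := Re x; set b1 := Im x; set a2 := Re _; set b2 := Im _ => h1 h2.
  lra.
(* t <= eta + t^2 / eta trades the distance for its square. *)
set d := cmod _; set t := k%:R * d.
have -> : k%:R ^+ 2 / eta * d ^+ 2 = t ^+ 2 / eta by rewrite /t exprMn mulrAC.
rewrite -subr_ge0.
have -> : eta + t ^+ 2 / eta - t = ((t - eta / 2) ^+ 2 + 3 / 4 * eta ^+ 2) / eta.
  by field; rewrite gt_eqF.
by rewrite divr_ge0 ?ltW // ltr_wpDl ?sqr_ge0 ?mulr_gt0 // exprn_gt0.
Qed.

(** Sampled at sufficiently many equidistant points of the circle of radius r, a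
    trigonometric polynomial c + 2 Re P has discrete moments equal to its Fourier
    coefficients, with no aliasing error. *)
Lemma trig_moment a M (r c : R) m : a 0 = 0 -> (m < M)%N ->
  let N := (M + M)%N in
  let P (j : 'I_N) := \sum_(i < M) a i * ((r%:C)%C * unity_root N ^+ j) ^+ i in
  \sum_j ((((c + 2 * Re (P j)) / N%:R)%:C)%C : C) * (unity_root N ^+ j)^* ^+ m
    = (if m == 0%N then (c%:C)%C else 0) + a m * (r%:C)%C ^+ m.
Proof.
(* With N = 2M, a frequency i - m or i + m is divisible by N only if it is 0;
   the case i = m gives the result, and i + m = 0 is excluded by a 0 = 0. *)
move=> a0 mM N P; have N0 : (0 < N)%N by rewrite /N; lia.
have NN : N%:R != 0 :> C by rewrite pnatr_eq0 -lt0n.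
have two z : ((2 * Re z)%:C)%C = z + z^* :> C.
  by apply: complex_ext; rewrite ?cReD ?cImD ?cReJ ?cImJ /=; ring.
pose z j := unity_root N ^+ j.
have -> : \sum_j ((((c + 2 * Re (P j)) / N%:R)%:C)%C : C) * (z j)^* ^+ m
  = N%:R^-1 * ((c%:C)%C *
      (\sum_(j < N) (z j) ^+ 0 * (z j)^* ^+ m)
    + \sum_(i < M) a i * (r%:C)%C ^+ i *
      (\sum_(j < N) (z j) ^+ i * (z j)^* ^+ m)
    + \sum_(i < M) (a i)^* * (r%:C)%C ^+ i *
      (\sum_(j < N) (z j)^* ^+ i * (z j)^* ^+ m)).
  under [X in _ = _ * (_ + X + _)]eq_bigr do rewrite mulr_sumr.
  under [X in _ = _ * (_ + X)]eq_bigr do rewrite mulr_sumr.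
  rewrite [X in _ = _ * (_ + X + _)]exchange_big /=.
  rewrite [X in _ = _ * (_ + X)]exchange_big /=.
  rewrite mulr_sumr -!big_split /= mulr_sumr; apply: eq_bigr => j _.
  rewrite fmorph_div /= (rmorphD (real_complex R)) /= two rmorph_nat.
  rewrite expr0 mul1r.
  have -> : \sum_(i < M) a i * (r%:C)%C ^+ i * ((z j) ^+ i * (z j)^* ^+ m)
     = P j * (z j)^* ^+ m.
    by rewrite /P mulr_suml; apply: eq_bigr => i _; rewrite exprMn !mulrA.
  have -> : \sum_(i < M) (a i)^* * (r%:C)%C ^+ i * ((z j)^* ^+ i * (z j)^* ^+ m)
     = (P j)^* * (z j)^* ^+ m.
    rewrite /P rmorph_sum /= mulr_suml; apply: eq_bigr => i _.
    have rmul (u v : C) : (u * v)^* = u^* * v^* by exact: rmorphM.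
    have rexp (u : C) n : (u ^+ n)^* = u^* ^+ n by exact: rmorphXn.
    rewrite rmul (rexp (_ * _)) rmul exprMn !mulrA.
    rewrite (_ : ((r%:C)%C : C)^* = (r%:C)%C) //.
    by apply: complex_ext; rewrite ?cReJ ?cImJ /= ?oppr0.
  by field.
have iN i : (i < M)%N -> (i < N)%N by rewrite /N; lia.
rewrite unity_root_orth ?iN // ?(leq_ltn_trans _ mM) //.
have -> : \sum_(i < M) (a i)^* * (r%:C)%C ^+ i *
      (\sum_(j < N) (z j)^* ^+ i * (z j)^* ^+ m) = 0.
  apply: big1 => i _; case: (posnP i) => [->|i0]; first by rewrite a0 rmorph0 !mul0r.
  by rewrite unity_root_orthJ ?mulr0 //; have := ltn_ord i; rewrite /N; lia.
have -> : \sum_(i < M) a i * (r%:C)%C ^+ i *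
      (\sum_(j < N) (z j) ^+ i * (z j)^* ^+ m)
  = a m * (r%:C)%C ^+ m * N%:R.
  rewrite (bigD1 (Ordinal mM)) //= unity_root_orth ?iN //.
  rewrite eqxx big1 ?addr0 // => i im.
  rewrite unity_root_orth ?iN // ifN ?mulr0 //.
rewrite eq_sym; case: eqP => _; by field.
Qed.

(** The weights are the samples on the circle of radius r of 1 + 2 Re F, with F
    replaced by a partial sum; the margin 2e compensates the truncation and keeps
    them nonnegative. *)
Lemma caratheodory_approx a F x (r e eta : R) k : pow_series a F ->
  (forall z, cmod z < 1 -> - 2^-1 < Re (F z)) ->
  a 0 = 0 -> a 1 = x -> cmod x = 1 -> 0 <= r < 1 -> 0 < e -> 0 < eta -> (0 < k)%N ->
  cmod (a k * (r%:C)%C ^+ k - ((1 + 2 * e)%:C)%C * x ^+ k)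
   <= (1 + 2 * e) * eta + k%:R ^+ 2 / eta * (2 * (1 + 2 * e - r)).
Proof.
move=> aF Fre a0 a1 x1 r01 e0 eta0 k0.
have [M0 HM] := pow_series_unif aF r01 e0.
pose M := (M0 + k + 2)%N; pose N := (M + M)%N.
case/andP: r01 => r0 r1.
pose P (j : 'I_N) := \sum_(i < M) a i * ((r%:C)%C * unity_root N ^+ j) ^+ i.
pose wt (j : 'I_N) := (1 + 2 * e + 2 * Re (P j)) / N%:R.
pose p (j : 'I_N) : C := (unity_root N ^+ j)^*.
have p1 j : cmod (p j) = 1 by rewrite /p cmodJ cmodX cmod_expi expr1n.
have mom m : (m < M)%N -> \sum_j ((wt j)%:C)%C * p j ^+ m =
  (if m == 0%N then ((1 + 2 * e)%:C)%C else 0) + a m * (r%:C)%C ^+ m.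
  by move=> mM; exact: trig_moment.
have W : \sum_j wt j = 1 + 2 * e.
  apply: (@complexI R); rewrite (rmorph_sum (real_complex R)) /=.
  have := mom 0%N; rewrite a0 mul0r addr0 => <- //; last by rewrite /M; lia.
  by apply: eq_bigr => j _; rewrite expr0 mulr1.
have w0 j : 0 <= wt j.
  rewrite /wt divr_ge0 //.
  have zr : cmod ((r%:C)%C * unity_root N ^+ j : C) = r.
    by rewrite cmodM cmodX cmod_expi expr1n mulr1 cmod_real ger0_norm.
  have h1 : cmod (F ((r%:C)%C * unity_root N ^+ j) - P j) <= e.
    by apply: HM; rewrite ?zr // /M; lia.
  have h2 : - 2^-1 < Re (F ((r%:C)%C * unity_root N ^+ j)) by apply: Fre; rewrite zr.
  have := le_trans (normRe_cmod _) h1.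
  by rewrite cReD cReN ler_norml => /andP[_]; lra.
have := concentrated_moments k W w0 p1 x1 eta0.
have -> : \sum_j ((wt j)%:C)%C * p j = x * (r%:C)%C.
  have := mom 1%N; rewrite a1 expr1 add0r => <- //.
  by rewrite /M; lia.
rewrite mom /M; last by lia.
rewrite gtn_eqF // add0r mulrA (mulrC (x^*)) unimod_mulJ // mul1r; exact.
Qed.

(** So F(z) = xz / (1 - xz), where x = F'(0) has modulus 1. This is the equality case
    of the Schwarz lemma for F / (1 + F), read on the coefficients. On the circle
    of radius r, 1 + 2 Re F is a positive density of mean 1 and first moment xr;
    as r tends to 1 it concentrates at a point of modulus 1. *)
Theorem caratheodory_extremal a F x k : pow_series a F ->
  (forall z, cmod z < 1 -> - 2^-1 < Re (F z)) ->
  a 0 = 0 -> a 1 = x -> cmod x = 1 -> (0 < k)%N -> a k = x ^+ k.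
Proof.
move=> aF Fre a0 a1 x1 k0; apply/eqP; rewrite -subr_eq0 -cmod_eq0.
rewrite eq_le cmod_ge0 andbT; apply/ler_addgt0Pr => e e0; rewrite add0r.
pose K := cmod (a k) * k%:R + 3 + 4 * k%:R ^+ 2.
have K0 : 0 < K.
  rewrite /K; have := sqr_ge0 (k%:R : R); have := cmod_ge0 (a k).
  have := ler0n R k => h1 h2 h3; have := mulr_ge0 h2 h1; lra.
pose t := Num.min 2^-1 (e / K).
have t0 : 0 < t by rewrite lt_min divr_gt0 // andbT invr_gt0.
have th : t <= 2^-1 by rewrite ge_min lexx.
have tK : K * t <= e by rewrite mulrC -ler_pdivlMr // ge_min lexx orbT.
apply: le_trans tK.
have t2 : 0 < t ^+ 2 by rewrite exprn_gt0.
have t2t : t ^+ 2 <= t by rewrite expr2 ger_pMl //; lra.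
have t21 : t ^+ 2 < 1 by lra.
have r01 : 0 <= 1 - t ^+ 2 < 1 by lra.
have e2 : 0 < t ^+ 2 / 2 by lra.
(* r = 1 - t^2 and e = t^2 / 2 make the defect 1 + 2e - r equal to 2 t^2, so
   that taking eta = t leaves an error of order t. *)
have := caratheodory_approx aF Fre a0 a1 x1 r01 e2 t0 k0.
have [r rE] : exists r, r = 1 - t ^+ 2 by exists (1 - t ^+ 2).
rewrite -rE; set A := (a k * _ - _) => HA.
have -> : a k - x ^+ k = a k * (1 - (r%:C)%C ^+ k) + A
   + ((t ^+ 2)%:C)%C * x ^+ k.
  rewrite /A (_ : 1 + 2 * (t ^+ 2 / 2) = 1 + t ^+ 2); last by field.
  by rewrite (rmorphD (real_complex R)) /= rmorph1; ring.
have h1 : cmod (1 - (r%:C)%C ^+ k) <= k%:R * t.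
  rewrite -(rmorphXn (real_complex R)) -(rmorph1 (real_complex R)).
  rewrite -(rmorphB (real_complex R)).
  rewrite cmod_real ger0_norm; last first.
    by rewrite subr_ge0 exprn_ile1 // ?rE; lra.
  apply: le_trans (_ : k%:R * t ^+ 2 <= _); last by rewrite ler_wpM2l.
  elim: (k) => [|n IH]; first by rewrite expr0 subrr mul0r.
  have rn : 0 <= r ^+ n <= 1.
    by rewrite exprn_ge0 ?exprn_ile1 // rE; lra.
  case/andP: rn => rn0 rn1.
  rewrite (exprS r) -(natr1 n) mulrDl (mul1r (t ^+ 2)).
  have -> : 1 - r * r ^+ n = (1 - r ^+ n) + (1 - r) * r ^+ n by ring.
  apply: lerD => //; rewrite {1}rE opprB addrC subrK.
  by rewrite ger_pMr.
have h2 : cmod A <= (2 + 4 * k%:R ^+ 2) * t.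
  apply: le_trans HA _.
  have -> : k%:R ^+ 2 / t * (2 * (1 + 2 * (t ^+ 2 / 2) - r)) = 4 * k%:R ^+ 2 * t.
    by rewrite rE; field; rewrite gt_eqF.
  rewrite [leRHS]mulrDl; apply: lerD => //; apply: ler_wpM2r; [exact: ltW|lra].
have h3 : cmod (((t ^+ 2)%:C)%C * x ^+ k) <= t.
  by rewrite cmodM cmodX x1 expr1n mulr1 cmod_real ger0_norm // ltW.
apply: le_trans (cmodD _ _) _; apply: le_trans (lerD (cmodD _ _) h3) _.
have h4 : cmod (a k * (1 - (r%:C)%C ^+ k)) <= cmod (a k) * (k%:R * t).
  by rewrite cmodM ler_wpM2l ?cmod_ge0.
apply: le_trans (lerD (lerD h4 h2) (lexx _)) _.
by rewrite /K; lra.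
Qed.

End Caratheodory.

(** * Curves in the complex plane and their images under holomorphic maps *)

Section Curves.
Variable R : realType.
Local Notation C := (Cplx R).
Local Notation Re := (@complex.Re R).
Local Notation Im := (@complex.Im R).
Implicit Types (F : C -> C) (z w D : C) (c : R -> C).

Definition curve_deriv c (t : R) (D : C) :=
  (fun h : R => ((h^-1)%:C)%C * (c (h + t) - c t)) @ 0^' --> D.

Lemma near0_lt (d : R) : 0 < d -> \forall h \near (0 : R)^', `|h| < d.
Proof.
move=> d0; rewrite near_withinE; exists d => //= h.
by rewrite /ball_ /= sub0r normrN.
Qed.

Lemma near0_neq : \forall h \near (0 : R)^', h != 0.
Proof. by rewrite near_withinE; exists 1 => //=. Qed.

Lemma curve_deriv_bound c t D : curve_deriv c t D ->
  \forall h \near (0 : R)^', cmod (c (h + t) - c t) <= (cmod D + 1) * `|h|.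
Proof.
move=> /cvgc_cmod /(_ 1 ltr01) H; near=> h.
have h0 : h != 0 by near: h; exact: near0_neq.
have hC : (h%:C)%C != 0 :> C by rewrite -cmod_eq0 cmod_real normr_eq0.
have -> : c (h + t) - c t = (((h^-1)%:C)%C * (c (h + t) - c t)) * (h%:C)%C.
  by rewrite (fmorphV (real_complex R)) /=; field.
rewrite cmodM cmod_real ler_wpM2r //.
set q := (_ * (c _ - _)).
have -> : q = D - (D - q) by ring.
rewrite (le_trans (cmodD _ _)) // cmodN lerD2l ltW //.
by rewrite /q; near: h; exact: H.
Unshelve. all: by end_near. Qed.

Lemma curve_deriv_comp c t a F D : curve_deriv c t a ->
  is_derive (c t) 1 F D -> curve_deriv (F \o c) t (D * a).
Proof.
move=> ca FD; apply/cvgc_cmod => e e0.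
have ca1 := curve_deriv_bound ca.
have A0 : 0 < cmod a + 1 by rewrite ltr_wpDl ?cmod_ge0.
have D0 : 0 < cmod D + 1 by rewrite ltr_wpDl ?cmod_ge0.
have e1 : 0 < e / 2 / (cmod a + 1) by rewrite !divr_gt0.
have e2 : 0 < e / 2 / (cmod D + 1) by rewrite !divr_gt0.
have [d d0 Hd] := is_derive_cmodP FD e1.
have /cvgc_cmod /(_ _ e2) cae := ca.
near=> h.
have h0 : h != 0 by near: h; exact: near0_neq.
have hh : 0 < `|h| by rewrite normr_gt0.
have b1 : cmod (c (h + t) - c t) <= (cmod a + 1) * `|h| by near: h; exact: ca1.
have b2 : `|h| < d / (cmod a + 1) by near: h; apply: near0_lt; rewrite divr_gt0.
have b3 : cmod (a - ((h^-1)%:C)%C * (c (h + t) - c t)) < e / 2 / (cmod D + 1).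
  by near: h; exact: cae.
have hC : (h%:C)%C != 0 :> C by rewrite -cmod_eq0 cmod_real normr_eq0.
have /Hd b4 : cmod (c (h + t) - c t) < d.
  by apply: le_lt_trans b1 _; rewrite mulrC -ltr_pdivlMr.
have -> : D * a - ((h^-1)%:C)%C * ((F \o c) (h + t) - (F \o c) t) =
   D * (a - ((h^-1)%:C)%C * (c (h + t) - c t))
   - ((h^-1)%:C)%C * (F (c (h + t)) - F (c t) - D * (c (h + t) - c t)).
  by rewrite /=; ring.
apply: le_lt_trans (cmodD _ _) _; rewrite (splitr e) cmodN.
apply: ltr_leD.
  rewrite cmodM; move: b3; rewrite ltr_pdivlMr // => b3.
  apply: le_lt_trans b3; rewrite mulrC ler_wpM2l ?cmod_ge0 //; lra.
rewrite cmodM cmod_real normfV mulrC ler_pdivrMr //.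
apply: le_trans b4 _; apply: le_trans (ler_wpM2l (ltW e1) b1) _.
by rewrite mulrA divfK // gt_eqF.
Unshelve. all: by end_near. Qed.

Lemma is_derive_cvg (f : R -> R) (t D : R) :
  (fun h : R => h^-1 * (f (h + t) - f t)) @ 0^' --> D -> is_derive t 1 f D.
Proof.
move=> H.
have H2 : (fun h : R => h^-1 *: ((f \o shift t) (h *: 1) - f t)) @ 0^' --> D.
  apply: cvg_trans H; apply: near_eq_cvg; near=> h.
  by rewrite /GRing.scale /= mulr1.
apply: DeriveDef; first by apply/cvg_ex; exists D.
by rewrite /derive; apply: (cvg_lim (@norm_hausdorff _ _)).
Unshelve. all: by end_near. Qed.

Lemma curve_deriv_Re c t D : curve_deriv c t D ->
  is_derive t 1 (fun t => Re (c t)) (Re D).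
Proof.
move=> /cvg_Rec H; apply: is_derive_cvg; apply: cvg_trans H.
by apply: near_eq_cvg; near=> h; rewrite Re_realM cReD cReN.
Unshelve. all: by end_near. Qed.

Lemma curve_deriv_Im c t D : curve_deriv c t D ->
  is_derive t 1 (fun t => Im (c t)) (Im D).
Proof.
move=> /cvg_Imc H; apply: is_derive_cvg; apply: cvg_trans H.
by apply: near_eq_cvg; near=> h; rewrite Im_realM cImD cImN.
Unshelve. all: by end_near. Qed.

Lemma curve_deriv_affine (p : C) (q : C) t :
  curve_deriv (fun t => p + (t%:C)%C * q) t q.
Proof.
have cq : (fun _ : R => q) @ (0 : R)^' --> q by exact: cvg_cst.
apply: cvg_trans cq.
apply: near_eq_cvg; near=> h.
have h0 : h != 0 by near: h; exact: near0_neq.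
have hC : (h%:C)%C != 0 :> C by rewrite -cmod_eq0 cmod_real normr_eq0.
by rewrite (rmorphD (real_complex R)) /= (fmorphV (real_complex R)) /=; field.
Unshelve. all: by end_near. Qed.

End Curves.

(** * Level curves over a half-plane *)

Section Shear.
Variable R : realType.
Local Notation C := (Cplx R).
Local Notation Re := (@complex.Re R).
Local Notation Im := (@complex.Im R).

Lemma mean_value (f df : R -> R) (a b : R) : a <= b ->
  (forall x, a <= x <= b -> is_derive x 1 f (df x)) ->
  exists2 c, a <= c <= b & f b - f a = df c * (b - a).
Proof.
move=> ab fdf.
have [|x|c] := @MVT_segment _ f df a b ab.
- by move=> x; rewrite in_itv /= => /andP[/ltW ax /ltW xb]; apply: fdf; rewrite ax.
- apply: derivable_within_continuous => z; rewrite in_itv /= => zab.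
  by have [] := fdf z zab.
- by rewrite in_itv /= => cab E; exists c.
Qed.

(** Q and L are the derivatives of Phi and K. The map under study is
    v |-> (Re K v, Im Phi v): a harmonic mapping written in the coordinates in
    which its imaginary part is that of the holomorphic function Phi. *)
Variables (Phi K Q L : C -> C).
Hypothesis dPhi : forall v : C, - 2^-1 < Re v -> is_derive v 1 Phi (Q v).
Hypothesis dK : forall v : C, - 2^-1 < Re v -> is_derive v 1 K (L v).
Hypothesis Qgt : forall v : C, - 2^-1 < Re v -> Re v + 2^-1 <= Re (Q v).
Hypothesis LQ : forall v : C, - 2^-1 < Re v -> 0 < Re (L v * (Q v)^*).

Local Notation pt t s := ((t +i* s)%C : C).

Lemma vertical_deriv (t s : R) : - 2^-1 < t ->
  is_derive s 1 (fun s => Im (Phi (pt t s))) (Re (Q (pt t s))).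
Proof.
move=> ht.
have cE : (fun s => pt t s) = (fun s => (t%:C)%C + (s%:C)%C * 'i%C).
  by apply/funext => u; apply: complex_ext;
    rewrite ?cReD ?cImD ?cReM ?cImM /= ?mulr0 ?mulr1 ?mul0r; ring.
have h : curve_deriv (fun s => pt t s) s ('i%C : C).
  by rewrite cE; exact: curve_deriv_affine.
have := curve_deriv_Im (curve_deriv_comp h (dPhi (ht : - 2^-1 < Re (pt t s)))).
by rewrite cImM /= mulr1 mulr0 addr0.
Qed.

Lemma vertical_growth (t s1 s2 : R) : - 2^-1 < t -> s1 <= s2 ->
  (t + 2^-1) * (s2 - s1) <= Im (Phi (pt t s2)) - Im (Phi (pt t s1)).
Proof.
move=> ht s12.
have [s _ ->] := mean_value s12 (fun s _ => vertical_deriv s ht).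
by apply: ler_wpM2r; rewrite ?subr_ge0 //; exact: (@Qgt (pt t s)).
Qed.

Lemma vertical_growth_norm (t s1 s2 : R) : - 2^-1 < t ->
  (t + 2^-1) * `|s2 - s1| <= `|Im (Phi (pt t s2)) - Im (Phi (pt t s1))|.
Proof.
move=> ht; have [s12|/ltW s12] := leP s1 s2.
  rewrite ger0_norm ?subr_ge0 //.
  by apply: le_trans (vertical_growth ht s12) _; exact: ler_norm.
rewrite distrC [leRHS]distrC ger0_norm ?subr_ge0 //.
by apply: le_trans (vertical_growth ht s12) _; exact: ler_norm.
Qed.

(** On the vertical line Re v = t the function Im Phi increases at speed at least
    t + 1/2, hence is onto. *)
Lemma level_exists (y t : R) : - 2^-1 < t -> exists s, Im (Phi (pt t s)) = y.
Proof.
move=> ht; have m0 : 0 < t + 2^-1 by lra.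
pose B := `|y - Im (Phi (pt t 0))| / (t + 2^-1).
have B0 : 0 <= B by rewrite divr_ge0 // ltW.
have hB : (t + 2^-1) * B = `|y - Im (Phi (pt t 0))|.
  by rewrite /B mulrC divfK // gt_eqF.
have NB : - B <= 0 by rewrite oppr_le0.
have h1 := vertical_growth ht B0; have h2 := vertical_growth ht NB.
rewrite subr0 hB in h1; rewrite sub0r opprK hB in h2.
have := ler_norm (y - Im (Phi (pt t 0))).
have := ler_norm (- (y - Im (Phi (pt t 0)))); rewrite normrN => h3 h4.
have [|||s _ <-] := @IVT _ (fun s => Im (Phi (pt t s))) (- B) B y; last by exists s.
- by lra.
- apply: derivable_within_continuous => z _.
  by have [] := vertical_deriv z ht.
- by rewrite ge_min le_max; apply/andP; split; apply/orP; [left|right]; lra.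
Qed.

Lemma level_unique (t s1 s2 : R) : - 2^-1 < t ->
  Im (Phi (pt t s1)) = Im (Phi (pt t s2)) -> s1 = s2.
Proof.
move=> ht E; have := vertical_growth_norm s2 s1 ht.
rewrite E subrr normr0 => h.
have m0 : 0 < t + 2^-1 by lra.
have : `|s1 - s2| <= 0 by rewrite -(pmulr_rle0 _ m0).
by rewrite normr_le0 subr_eq0 => /eqP.
Qed.

Section OneLevel.
Variables (y : R) (s : R -> R).
Hypothesis sP : forall t : R, - 2^-1 < t -> Im (Phi (pt t (s t))) = y.

(** Implicit differentiation. Since vertical growth is bounded below, the level
    curve is Lipschitz near t, with constant B; the first-order expansion of Phi
    then determines the slope. *)
Lemma level_deriv (t : R) : - 2^-1 < t ->
  is_derive t 1 s (- Im (Q (pt t (s t))) / Re (Q (pt t (s t)))).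
Proof.
move=> ht; set v := pt t (s t); set q := Q v.
have m0 : 0 < t + 2^-1 by lra.
have q0 : 0 < Re q by apply: lt_le_trans m0 _; exact: (@Qgt v).
have ev e (e0 : 0 < e) := is_derive_cmodP (dPhi (ht : - 2^-1 < Re v)) e0.
have [d1 d10 Hd1] := ev 1 ltr01.
pose B := 2 * (cmod q + 1) / (t + 2^-1).
have B0 : 0 <= B.
  by apply: divr_ge0; [rewrite mulr_ge0 // addr_ge0 // cmod_ge0 | exact: ltW].
(* At height s t, moving horizontally by h changes Im Phi by at most
   (|q| + 1) |h|; returning to the level costs a vertical move that is bounded
   by the growth estimate. *)
have hs (h : R) : `|h| < d1 -> `|h| < (t + 2^-1) / 2 ->
    `|s (h + t) - s t| <= B * `|h|.
  move=> hd ht2.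
  have hlow : (t + 2^-1) / 2 <= h + t + 2^-1.
    by move: ht2; rewrite ltr_norml => /andP[? ?]; lra.
  have ht' : - 2^-1 < h + t by lra.
  have := vertical_growth_norm (s t) (s (h + t)) ht'.
  rewrite (sP ht') -(sP ht).
  have wv : pt (h + t) (s t) - v = (h%:C)%C.
    by apply: complex_ext; rewrite ?cReD ?cImD ?cReN ?cImN /v /=; ring.
  have := Hd1 (pt (h + t) (s t)); rewrite wv cmod_real mul1r => /(_ hd) hPhi.
  have {}hPhi : cmod (Phi (pt (h + t) (s t)) - Phi v) <= (cmod q + 1) * `|h|.
    have -> : Phi (pt (h + t) (s t)) - Phi v = q * (h%:C)%C +
      (Phi (pt (h + t) (s t)) - Phi v - q * (h%:C)%C) by ring.
    by rewrite mulrDl mul1r (le_trans (cmodD _ _)) // lerD // cmodM cmod_real.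
  have := le_trans (normIm_cmod _) hPhi; rewrite cImD cImN distrC => h1 h2.
  have h3 := le_trans h2 h1.
  have h4 : (t + 2^-1) / 2 * `|s (h + t) - s t| <= (cmod q + 1) * `|h|.
    by apply: le_trans h3; rewrite ler_wpM2r.
  rewrite /B mulrAC ler_pdivlMr //.
  have -> : `|s (h + t) - s t| * (t + 2^-1)
     = 2 * ((t + 2^-1) / 2 * `|s (h + t) - s t|) by field.
  by rewrite -[leRHS]mulrA; apply: ler_wpM2l.
apply: is_derive_cvg; apply/cvgrPdist_lt => e e0.
pose e1 := e / 2 * Re q / (1 + B).
have e10 : 0 < e1 by rewrite /e1 divr_gt0 ?mulr_gt0 ?divr_gt0 // ltr_pwDl.
have [d2 d20 Hd2] := ev e1 e10.
have B1 : 0 < 1 + B by rewrite ltr_pwDl.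
near=> h.
have h0 : h != 0 by near: h; exact: near0_neq.
have hh : 0 < `|h| by rewrite normr_gt0.
have hd1 : `|h| < d1 by near: h; exact: near0_lt.
have ht2 : `|h| < (t + 2^-1) / 2 by near: h; apply: near0_lt; rewrite divr_gt0.
have hd2 : `|h| < d2 / (1 + B) by near: h; apply: near0_lt; rewrite divr_gt0.
have hsB := hs h hd1 ht2.
pose w := pt (h + t) (s (h + t)).
have wvE : w - v = (h +i* (s (h + t) - s t))%C.
  by apply: complex_ext; rewrite ?cReD ?cImD ?cReN ?cImN /v /=; ring.
have wvn : cmod (w - v) <= (1 + B) * `|h|.
  rewrite wvE mulrDl mul1r; apply: le_trans (cmod_le_ReIm _) _ => /=.
  by rewrite lerD2l.
have ht' : - 2^-1 < h + t by move: ht2; rewrite ltr_norml => /andP[? ?]; lra.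
have /Hd2 hw : cmod (w - v) < d2.
  by apply: le_lt_trans wvn _; rewrite mulrC -ltr_pdivlMr.
have := le_trans (normIm_cmod _) (le_trans hw (ler_wpM2l (ltW e10) wvn)).
rewrite !cImD !cImN (sP ht') (sP ht) subrr sub0r normrN wvE cImM /=.
move=> key.
have -> : - Im q / Re q - h^-1 * (s (h + t) - s t)
  = - (Re q * (s (h + t) - s t) + Im q * h) / (Re q * h).
  by field; rewrite h0 gt_eqF.
rewrite normrM normrN normfV normrM (gtr0_norm q0).
rewrite ltr_pdivrMr ?mulr_gt0 //; apply: le_lt_trans key _.
rewrite /e1 mulrA divfK ?gt_eqF //.
by rewrite -[ltLHS]mulrA ltr_pM2r ?mulr_gt0 //; lra.
Unshelve. all: by end_near. Qed.

(** Along a level curve of Im Phi the velocity is a positive multiple of conj Q,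
    and Re (L conj Q) > 0. *)
Lemma level_ReK_deriv (t : R) : - 2^-1 < t -> exists2 D : R, 0 < D &
  is_derive t 1 (fun t => Re (K (pt t (s t)))) D.
Proof.
move=> ht; set v := pt t (s t).
have hv : - 2^-1 < Re v by [].
have q0 : 0 < Re (Q v) by apply: lt_le_trans (Qgt hv); rewrite /=; lra.
set s' := - Im (Q v) / Re (Q v).
have hc : curve_deriv (fun t => pt t (s t)) t ((1 +i* s')%C : C).
  have ds := level_deriv ht.
  apply: cvgc_ReIm.
    have c1 : (fun _ : R => 1 : R) @ (0 : R)^' --> (1 : R) by exact: cvg_cst.
    apply: cvg_trans c1; apply: near_eq_cvg; near=> h.
    have h0 : h != 0 by near: h; exact: near0_neq.
    by rewrite Re_realM cReD cReN /= addrK mulVf.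
  have [ds1 ds2] := ds.
  have H : (fun h : R => h^-1 *: ((s \o shift t) (h *: 1) - s t)) @ 0^' --> s'.
    by rewrite -[s']ds2; exact: ds1.
  apply: cvg_trans H; apply: near_eq_cvg; near=> h.
  by rewrite Im_realM cImD cImN /= /GRing.scale /= mulr1.
have dR := curve_deriv_Re (curve_deriv_comp hc (dK hv)).
exists (Re (L v * (1 +i* s')%C)) => //.
have -> : Re (L v * (1 +i* s')%C) = Re (L v * (Q v)^*) / Re (Q v).
  by rewrite !cReM cReJ cImJ /s' /=; field; rewrite gt_eqF.
by rewrite divr_gt0 // LQ.
Unshelve. all: by end_near. Qed.

Lemma level_ReK_incr (t1 t2 : R) : - 2^-1 < t1 -> t1 < t2 ->
  Re (K (pt t1 (s t1))) < Re (K (pt t2 (s t2))).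
Proof.
move=> h1 h12; pose f t := Re (K (pt t (s t))).
have fd x : t1 <= x <= t2 -> is_derive x 1 f (derive1 f x).
  move=> /andP[/(lt_le_trans h1) hx _]; have [D _ fD] := level_ReK_deriv hx.
  by rewrite derive1E derive_val.
have [c /andP[/(lt_le_trans h1) hc _] E] := mean_value (ltW h12) fd.
rewrite -subr_gt0 -/(f t1) -/(f t2) E mulr_gt0 ?subr_gt0 //.
by have [D D0 fD] := level_ReK_deriv hc; rewrite derive1E derive_val.
Qed.

End OneLevel.

(** Two points with the same image lie on one level curve, which is a graph over
    the real part, and Re K is strictly increasing along it. *)
Theorem shear_injective (v1 v2 : C) : - 2^-1 < Re v1 -> - 2^-1 < Re v2 ->
  Re (K v1) = Re (K v2) -> Im (Phi v1) = Im (Phi v2) -> v1 = v2.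
Proof.
move=> h1 h2 EK EP.
have /choice[s sP] t : exists u, - 2^-1 < t -> Im (Phi (pt t u)) = Im (Phi v1).
  have [ht|_] := ltP (- 2^-1) t; last by exists 0.
  by have [u uP] := level_exists (Im (Phi v1)) ht; exists u.
have on v : - 2^-1 < Re v -> Im (Phi v) = Im (Phi v1) -> v = pt (Re v) (s (Re v)).
  move=> hv E; have /= := sP _ hv; rewrite -E; case: v hv E => a b /= ha E E2.
  by rewrite (level_unique ha E2).
have E1 := on _ h1 erefl; have E2 := on _ h2 (esym EP).
have [lt|gt|E] := ltgtP (Re v1) (Re v2).
- have := level_ReK_incr sP h1 lt.
  by rewrite -E1 -E2 EK ltxx.
- have := level_ReK_incr sP h2 gt.
  by rewrite -E1 -E2 EK ltxx.
- by rewrite E1 E2 E.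
Qed.

(** A horizontal slice of the image is the continuous image of the parameter
    interval of one level curve. *)
Theorem shear_level_connected (y : R) :
  connected [set Re (K v) | v in [set v | - 2^-1 < Re v /\ Im (Phi v) = y]].
Proof.
have /choice[s sP] t : exists u, - 2^-1 < t -> Im (Phi (pt t u)) = y.
  have [ht|_] := ltP (- 2^-1) t; last by exists 0.
  by have [u uP] := level_exists y ht; exists u.
have -> : [set Re (K v) | v in [set v | - 2^-1 < Re v /\ Im (Phi v) = y]]
   = (fun t : R => Re (K (pt t (s t)))) @` [set` `]- (2^-1 : R), +oo[%R].
  apply/seteqP; split=> x /=.
    move=> [v [hv E] <-]; exists (Re v); first by rewrite in_itv /= hv.
    congr (Re (K _)); case: v hv E => a b /= ha E.
    by rewrite (level_unique ha (etrans (sP _ ha) (esym E))).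
  move=> [t]; rewrite ?in_itv /= andbT => ht <-.
  by exists (pt t (s t)) => //; split => //; exact: sP.
apply: connected_continuous_connected.
  by apply/connected_intervalP; exact: interval_is_interval.
apply: derivable_within_continuous => t; rewrite in_itv /= andbT => ht.
by have [D _ []] := level_ReK_deriv sP ht.
Qed.

End Shear.

(** * Shears of the unit disk along a half-plane map *)

Section DiskShear.
Variable R : realType.
Local Notation C := (Cplx R).
Local Notation Re := (@complex.Re R).
Local Notation Im := (@complex.Im R).

(** With x of modulus 1, the function xz / (1 - xz) maps the disk onto the
    half-plane Re v > -1/2; H' and G' are the derivatives of H and G. The last
    hypothesis says that, in the coordinate v, the derivative of x (H - y^2 G)
    has real part at least Re v + 1/2. *)
Variables (x y : C) (H G H' G' : C -> C).
Hypothesis x1 : cmod x = 1.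
Hypothesis yE : y = x^*.
Hypothesis dH : forall z : C, cmod z < 1 -> is_derive z 1 H (H' z).
Hypothesis dG : forall z : C, cmod z < 1 -> is_derive z 1 G (G' z).
Hypothesis dil_lt : forall z : C, cmod z < 1 -> cmod (G' z) < cmod (H' z).
Hypothesis shear_Re : forall z : C, cmod z < 1 ->
  Re (1 - x * z)^-1 - 2^-1 <= Re ((H' z - y ^+ 2 * G' z) * (1 - x * z) ^+ 2).

Let y1 : cmod y = 1. Proof. by rewrite yE cmodJ. Qed.
Let xy : x * y = 1. Proof. by rewrite yE; exact: unimod_mulJ. Qed.
Let yx : y * x = 1. Proof. by rewrite mulrC. Qed.

(** Inverse of v = xz / (1 - xz), as v / (1 + v) = 1 - 1 / (1 + v). *)
Let zof (v : C) : C := y * (1 - (1 + v)^-1).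

Lemma half_plane_neq0 (v : C) : - 2^-1 < Re v -> 1 + v != 0.
Proof.
move=> hv; apply/eqP => /(congr1 Re); rewrite cReD /= => E; move: hv; lra.
Qed.

Let zof_x (v : C) : 1 - x * zof v = (1 + v)^-1.
Proof. by rewrite /zof mulrA xy mul1r opprB addrC subrK. Qed.

Let zof_disk (v : C) : - 2^-1 < Re v -> cmod (zof v) < 1.
Proof.
move=> hv; have v0 := half_plane_neq0 hv.
have -> : zof v = y * (v / (1 + v)).
  by rewrite /zof; congr (y * _); field.
rewrite cmodM y1 mul1r cmodM cmodV ltr_pdivrMr ?cmod_gt0 // mul1r cmod_lt_sqr.
by rewrite !sqr_cmod cReD cImD /=; lra.
Qed.

Let zof_surj (z : C) : cmod z < 1 -> exists2 v : C, - 2^-1 < Re v & zof v = z.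
Proof.
move=> z1; have xz1 : cmod (x * z) < 1 by rewrite cmodM x1 mul1r.
exists ((1 - x * z)^-1 - 1).
  have := Re_inv1D (w := - (x * z)); rewrite cmodN => /(_ xz1).
  by rewrite cReD cReN /=; lra.
have e : 1 + ((1 - x * z)^-1 - 1) = (1 - x * z)^-1 by rewrite addrC subrK.
by rewrite /zof e invrK subKr mulrA yx mul1r.
Qed.

Let jac (v : C) : C := y * (1 + v)^-1 ^+ 2.

Let zof_deriv (v : C) : - 2^-1 < Re v -> is_derive v 1 zof (jac v).
Proof.
move=> hv; have v0 : 1 - (-1) * v != 0 by rewrite mulN1r opprK half_plane_neq0.
have -> : zof = (fun v => y * (1 + (-1) * (1 - (-1) * v)^-1 ^+ 1)).
  by apply/funext => w; rewrite /zof expr1 !mulN1r opprK.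
apply: (is_derive_eq (cderiv_scale y (cderiv_add (is_derive_cst (1 : C) v 1)
  (cderiv_scale (-1) (is_derive_inv1B 1 v0))))).
by rewrite /jac (mulN1r v) opprK; ring.
Qed.

Let Phi (v : C) : C := x * H (zof v) - y * G (zof v).
Let K (v : C) : C := x * H (zof v) + y * G (zof v).
Let Q (v : C) : C := (x * H' (zof v) - y * G' (zof v)) * jac v.
Let L (v : C) : C := (x * H' (zof v) + y * G' (zof v)) * jac v.

Let dPhi (v : C) : - 2^-1 < Re v -> is_derive v 1 Phi (Q v).
Proof.
move=> hv; have z1 := zof_disk hv.
have dHz := cderiv_comp (dH z1) (zof_deriv hv).
have dGz := cderiv_comp (dG z1) (zof_deriv hv).
have -> : Phi = (fun v => x * (H \o zof) v + - y * (G \o zof) v).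
  by apply/funext => w; rewrite /Phi mulNr.
apply: (is_derive_eq (cderiv_add (cderiv_scale x dHz) (cderiv_scale (- y) dGz))).
by rewrite /Q; ring.
Qed.

Let dK (v : C) : - 2^-1 < Re v -> is_derive v 1 K (L v).
Proof.
move=> hv; have z1 := zof_disk hv.
have dHz := cderiv_comp (dH z1) (zof_deriv hv).
have dGz := cderiv_comp (dG z1) (zof_deriv hv).
apply: (is_derive_eq (cderiv_add (cderiv_scale x dHz) (cderiv_scale y dGz))).
by rewrite /L; ring.
Qed.

Let Qgt (v : C) : - 2^-1 < Re v -> Re v + 2^-1 <= Re (Q v).
Proof.
move=> hv; have := shear_Re (zof_disk hv); rewrite zof_x invrK.
have -> : (H' (zof v) - y ^+ 2 * G' (zof v)) * (1 + v)^-1 ^+ 2 = Q v.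
  rewrite /Q /jac; move: (H' _) (G' _) (_^-1 ^+ 2) => p q t.
  transitivity ((x * y * p - y ^+ 2 * q) * t); first by rewrite xy mul1r.
  by ring.
by rewrite cReD /=; lra.
Qed.

(** Re ((s + t) conj (s - t)) = |s|^2 - |t|^2, so this is the condition that the
    mapping preserves orientation. *)
Let LQ (v : C) : - 2^-1 < Re v -> 0 < Re (L v * (Q v)^*).
Proof.
move=> hv; have := dil_lt (zof_disk hv); rewrite cmod_lt_sqr.
rewrite /L /Q; move: (H' _) (G' _) => A B AB.
have j0 : 0 < cmod (jac v) ^+ 2.
  rewrite exprn_gt0 // cmod_gt0 mulf_neq0 ?expf_neq0 ?invr_eq0 ?half_plane_neq0 //.
  exact: unimod_neq0.
have E (s t k : C) : Re (((s + t) * k) * ((s - t) * k)^*)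
    = cmod k ^+ 2 * (cmod s ^+ 2 - cmod t ^+ 2).
  rewrite !sqr_cmod cReM cReJ cImJ !cReM !cImM !cReD !cImD !cReN !cImN.
  by ring.
by rewrite E mulr_gt0 // subr_gt0 !cmodM x1 y1 !mul1r.
Qed.

Let ff (z : C) : C := H z + (G z)^*.

(** Rotated by x, the harmonic mapping has real part Re K and imaginary part
    Im Phi, because conj y = x. *)
Let ffE (v : C) : x * ff (zof v) = ((Re (K v)) +i* (Im (Phi v)))%C.
Proof.
rewrite /ff /K /Phi yE; move: (H _) (G _) => A B.
apply: complex_ext;
  by rewrite /= !(cReM, cImM, cReD, cImD, cReN, cImN, cReJ, cImJ); ring.
Qed.

Theorem disk_shear_injective (z1 z2 : C) : cmod z1 < 1 -> cmod z2 < 1 ->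
  H z1 + (G z1)^* = H z2 + (G z2)^* -> z1 = z2.
Proof.
move=> /zof_surj[v1 hv1 <-] /zof_surj[v2 hv2 <-] E.
have : x * ff (zof v1) = x * ff (zof v2) by rewrite /ff E.
rewrite !ffE => -[E1 E2].
by rewrite (shear_injective dPhi dK Qgt LQ hv1 hv2 E1 E2).
Qed.

(** The line through c in the direction y is rotated by x onto the horizontal line
    at height Im (x c). *)
Theorem disk_shear_connected (c : C) :
  connected [set w : C | (exists2 z : C, cmod z < 1 & H z + (G z)^* = w) /\
                         (exists t : R, w = c + (t%:C)%C * y)].
Proof.
set y0 := Im (x * c).
set S := (X in connected X).
have -> : S = (fun r : R => y * ((r +i* y0)%C : C)) @`
   [set Re (K v) | v in [set v : C | - 2^-1 < Re v /\ Im (Phi v) = y0]].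
  apply/seteqP; split=> w /=.
    move=> [[z /zof_surj[v hv <-] <-] [t E]]; rewrite -/(ff _) in E *.
    have E2 : x * ff (zof v) = x * c + (t%:C)%C.
      by rewrite E mulrDr mulrCA xy mulr1.
    have E3 := ffE v.
    have E4 : Im (Phi v) = y0.
      have -> : Im (Phi v) = Im (x * ff (zof v)) by rewrite E3.
      by rewrite E2 cImD /= addr0.
    exists (Re (K v)); first by exists v.
    by rewrite -E4 -E3 mulrA yx mul1r.
  move=> [_ [v [hv Ev] <-] <-]; have E3 := ffE v; rewrite Ev in E3.
  have E4 : y * ((Re (K v) +i* y0)%C : C) = ff (zof v).
    by rewrite -E3 mulrA yx mul1r.
  split; first by exists (zof v); [exact: zof_disk | rewrite E4].
  exists (Re (K v) - Re (x * c)).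
  transitivity (y * (x * c + ((Re (K v) - Re (x * c))%:C)%C)); last first.
    by rewrite mulrDr mulrA yx mul1r [y * _]mulrC.
  congr (y * _); apply: complex_ext; rewrite ?cReD ?cImD /=; first by ring.
  by rewrite addr0.
apply: connected_continuous_connected.
  exact: (shear_level_connected dPhi dK Qgt LQ).
apply: continuous_subspaceT => r.
apply: cvgM; first exact: cvg_cst.
apply: cvgc_ReIm; first exact: cvg_id.
exact: cvg_cst.
Qed.

End DiskShear.

(** * Convolution with f0 *)

Section ConvolutionF0.
Variable R : realType.
Local Notation C := (Cplx R).
Local Notation Re := (@complex.Re R).
Local Notation Im := (@complex.Im R).
Implicit Types (a b : nat -> C) (h g : C -> C) (z : C).

Lemma pow_series_geom2 :
  pow_series (fun n => n.+1%:R) (fun z : C => (1 - z)^-1 ^+ 2).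
Proof.
apply: (pow_series_eq _ _ (pow_series_derive1 (@pow_series_geom R))).
  by move=> n; rewrite /dcoef mulr1.
move=> z z1; apply: is_derive_derive1.
have := @is_derive_inv1B R 1 z 1; rewrite !mul1r => /(_ (nonzero_1B z1)).
by under eq_fun do rewrite mul1r expr1.
Qed.

(** Here h0 = (1 / (1 - z)^2 - 1) / 2. *)
Lemma pow_series_h0 :
  pow_series (fun n => if n is k.+1 then k.+2%:R / 2 else 0)
    (analytic_part (f0 R)).
Proof.
have H := pow_seriesD (@pow_seriesZ _ 2^-1 _ _ pow_series_geom2)
  (@pow_series_cst _ (- 2^-1)).
apply: pow_series_eq H.
  by case=> [|n] /=; field.
by move=> z /nonzero_1B nz /=; field.
Qed.

(** Here g0 = 1 / (1 - z) - 1 / (2 (1 - z)^2) - 1 / 2. *)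
Lemma pow_series_g0 :
  pow_series (fun n => if n is k.+1 then - k%:R / 2 else 0)
    (coanalytic_part (f0 R)).
Proof.
have H := pow_seriesD (@pow_series_geom R) (pow_seriesD
  (@pow_seriesZ _ (- 2^-1) _ _ pow_series_geom2) (@pow_series_cst _ (- 2^-1))).
apply: pow_series_eq H.
  case=> [|n] /=; first by field.
  by rewrite -!(natr1 n.+1) -(natr1 n); field.
by move=> z /nonzero_1B nz /=; field.
Qed.

(** Multiplying the n-th coefficient by n is the operator z d/dz, so convolution
    with h0 is a first-order differential operator. *)
Lemma pow_series_hadamard_h0 a h : pow_series a h -> a 0 = 0 ->
  pow_series (fun n => n.+1%:R / 2 * a n) (hadamard (analytic_part (f0 R)) h) /\
  forall z, cmod z < 1 ->
    hadamard (analytic_part (f0 R)) h z = 2^-1 * (h z + z * derive1 h z).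
Proof.
move=> ah a0.
have HS : pow_series (fun n => n.+1%:R / 2 * a n)
    (fun z => 2^-1 * (h z + z * derive1 h z)).
  have HS := @pow_seriesZ _ 2^-1 _ _ (pow_seriesD ah
    (pow_series_mulX (pow_series_derive1 ah))).
  apply: pow_series_eq HS => [|//] -[|n] /=.
    by rewrite a0; ring.
  by rewrite /dcoef -(natr1 n.+1); field.
have HE z : cmod z < 1 -> hadamard (analytic_part (f0 R)) h z
    = 2^-1 * (h z + z * derive1 h z).
  apply: (hadamard_pow_series pow_series_h0 ah
    (F := fun z => 2^-1 * (h z + z * derive1 h z))).
  apply: pow_series_eq HS => [|//] -[|n] //.
  by rewrite a0 !mulr0.
split; last exact: HE.
by apply: pow_series_eq HS => [//|z z1]; rewrite HE.
Qed.

Lemma pow_series_hadamard_g0 b g : pow_series b g -> b 0 = 0 ->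
  pow_series (fun n => (1 - n%:R) / 2 * b n) (hadamard (coanalytic_part (f0 R)) g) /\
  forall z, cmod z < 1 ->
    hadamard (coanalytic_part (f0 R)) g z = 2^-1 * (g z - z * derive1 g z).
Proof.
move=> bg b0.
have HS : pow_series (fun n => (1 - n%:R) / 2 * b n)
    (fun z => 2^-1 * (g z - z * derive1 g z)).
  have HS := @pow_seriesZ _ 2^-1 _ _ (pow_seriesD bg
    (@pow_seriesZ _ (-1) _ _ (pow_series_mulX (pow_series_derive1 bg)))).
  apply: pow_series_eq HS.
    case=> [|n] /=; first by rewrite b0; ring.
    by rewrite /dcoef -(natr1 n); field.
  by move=> z _; rewrite mulN1r.
have HE z : cmod z < 1 -> hadamard (coanalytic_part (f0 R)) g z
    = 2^-1 * (g z - z * derive1 g z).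
  apply: (hadamard_pow_series pow_series_g0 bg
    (F := fun z => 2^-1 * (g z - z * derive1 g z))).
  apply: pow_series_eq HS => [|//] -[|n] /=.
    by rewrite b0 !mulr0.
  by rewrite -(natr1 n); field.
split; last exact: HE.
by apply: pow_series_eq HS => [//|z z1]; rewrite HE.
Qed.

Lemma derive1_hadamard_h0 a h z : pow_series a h -> a 0 = 0 -> cmod z < 1 ->
  derive1 (hadamard (analytic_part (f0 R)) h) z
    = 2^-1 * (2 * derive1 h z + z * derive1 (derive1 h) z).
Proof.
move=> ah a0 z1; have [_ HE] := pow_series_hadamard_h0 ah a0.
rewrite (derive1_eq_disk HE z1).
have dh := pow_series_is_derive ah z1.
have dh' := pow_series_is_derive (pow_series_derive1 ah) z1.
rewrite (is_derive_derive1 (cderiv_scale 2^-1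
  (cderiv_add dh (cderiv_mul (is_derive_id z 1) dh')))).
by move: (derive1 (derive1 h) z) (derive1 h z) => p q /=; ring.
Qed.

Lemma derive1_hadamard_g0 b g z : pow_series b g -> b 0 = 0 -> cmod z < 1 ->
  derive1 (hadamard (coanalytic_part (f0 R)) g) z
    = - 2^-1 * (z * derive1 (derive1 g) z).
Proof.
move=> bg b0 z1; have [_ HE] := pow_series_hadamard_g0 bg b0.
have HE' (w : C) : cmod w < 1 -> hadamard (coanalytic_part (f0 R)) g w
    = 2^-1 * (g w + (-1) * (w * derive1 g w)) by rewrite mulN1r; exact: HE.
rewrite (derive1_eq_disk HE' z1).
have dg := pow_series_is_derive bg z1.
have dg' := pow_series_is_derive (pow_series_derive1 bg) z1.
rewrite (is_derive_derive1 (cderiv_scale 2^-1 (cderiv_add dg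
  (cderiv_scale (-1) (cderiv_mul (is_derive_id z 1) dg'))))).
by move: (derive1 (derive1 g) z) (derive1 g z) => p q /=; ring.
Qed.

Lemma sense_preserving_cmod (f : harmonic_map R) : sense_preserving f <->
  forall z, cmod z < 1 ->
    cmod (derive1 (coanalytic_part f) z) < cmod (derive1 (analytic_part f) z).
Proof.
have E z : (0 < `|derive1 (analytic_part f) z| ^+ 2
     - `|derive1 (coanalytic_part f) z| ^+ 2) =
    (cmod (derive1 (coanalytic_part f) z) < cmod (derive1 (analytic_part f) z)).
  move: (derive1 _ z) (derive1 _ z) => p q.
  by rewrite !normcE_cmod -!(rmorphXn (real_complex R)) subr_gt0 ltcR cmod_lt_sqr.
split=> H z; first by move=> z1; rewrite -E; apply: H; rewrite unit_diskE.
by rewrite unit_diskE E => /H.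
Qed.

End ConvolutionF0.

(** * The dilatation of the convolution *)

Section Dilatation.
Variable R : realType.
Local Notation C := (Cplx R).
Local Notation Re := (@complex.Re R).
Local Notation Im := (@complex.Im R).

(** Up to the factor c, the polynomial on the left is the reciprocal of the one on
    the right; their quotient is a Blaschke product, and this is Cohn's criterion
    for it made explicit. *)
Lemma reciprocal_quadratic_lt (u c : C) : cmod u < 1 -> cmod c = 1 ->
  cmod (1 + u + 2 * c * u ^+ 2) < cmod (2 + c * u + c * u ^+ 2).
Proof.
move=> u1 c1; rewrite cmod_lt_sqr.
have hu := normRe_cmod u; have hcu := normRe_cmod (c * u).
rewrite cmodM c1 mul1r in hcu.
have u0 := cmod_ge0 u; set r := cmod u in hu hcu u0 u1 *.
have rE : r ^+ 2 = Re u ^+ 2 + Im u ^+ 2 by exact: sqr_cmod.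
have cE : Re c ^+ 2 + Im c ^+ 2 = 1 by rewrite -sqr_cmod c1 expr1n.
rewrite -subr_gt0.
(* The last factor is at least 3 (1 - r)^2, as Re u and Re (c u) are bounded
   by r in absolute value. *)
have -> : cmod (2 + c * u + c * u ^+ 2) ^+ 2 - cmod (1 + u + 2 * c * u ^+ 2) ^+ 2
  = (1 - r ^+ 2) * (3 + 3 * r ^+ 2 - 2 * Re u + 4 * Re (c * u)).
  rewrite !sqr_cmod; move: cE; rewrite {hu hcu rE r u0 u1 c1}.
  case: c => c1 c2; case: u => a b /= cE.
  apply/eqP; rewrite -subr_eq0; apply/eqP.
  transitivity ((c1 ^+ 2 + c2 ^+ 2 - 1) *
    ((a ^+ 2 + b ^+ 2) * ((1 + a) ^+ 2 + b ^+ 2) - 4 * (a ^+ 2 + b ^+ 2) ^+ 2));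
    last by rewrite cE subrr mul0r.
  ring.
have r2 : r ^+ 2 < 1 by rewrite expr_lt1.
rewrite mulr_gt0 ?subr_gt0 //.
move: hu hcu; rewrite !ler_norml => /andP[_ hu] /andP[hcu _].
have : 0 < (1 - r) ^+ 2 by rewrite exprn_gt0 // subr_gt0.
lra.
Qed.

(** At a point z of the disk, with u = xz, read p = h'(z), s = z h''(z),
    q = x^-2 z g''(z), and c u^n for x^-2 times the dilatation of f. The claim is
    that the dilatation -z g'' / (2 h' + z h'') of the convolution has modulus less
    than 1. Eliminating p and s, it is u^2 times a unimodular constant when n = 2,
    and u times a Blaschke product of degree at most 2 when n = 1. *)
Lemma conv_dilatation_lt (n : nat) (u c p s q : C) : (n = 1%N \/ n = 2%N) ->
  cmod u < 1 -> cmod c = 1 ->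
  (1 + c * u ^+ n) * p = (1 - u)^-1 ^+ 2 ->
  s + q = 2 * u * (1 - u)^-1 ^+ 3 ->
  q = n%:R * (c * u ^+ n) * p + c * u ^+ n * s ->
  cmod q < cmod (2 * p + s).
Proof.
move=> n12 u1 c1 E1 E2 E3; set w := c * u ^+ n in E1 E3.
have un : cmod w < 1.
  rewrite /w cmodM c1 mul1r cmodX expr_lt1 ?cmod_ge0 //.
  by case: n12 => ->.
have w1 := nonzero_1D un; have u1n := nonzero_1B u1.
(* k clears the denominators of 2 p + s and q. *)
pose k := (1 + w) ^+ 2 * (1 - u) ^+ 3.
have k0 : k != 0 by rewrite mulf_neq0 // expf_neq0.
have pE : p = (1 - u)^-1 ^+ 2 / (1 + w) by rewrite -E1; field.
have sE : s = (2 * u * (1 - u)^-1 ^+ 3 - n%:R * w * p) / (1 + w).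
  by rewrite -E2 E3; field.
have DEN : k * (2 * p + s) = 2 * (1 + w) - n%:R * w * (1 - u).
  by rewrite sE pE /k; field; rewrite w1.
have NUM : k * q = w * (n%:R * (1 - u) + 2 * u * (1 + w)).
  by rewrite E3 sE pE /k; field; rewrite w1.
rewrite -(ltr_pM2l (_ : 0 < cmod k)) ?cmod_gt0 // -!cmodM DEN NUM.
clear -n12 u1 c1 un; rewrite {}/w in un *.
case: n12 un => -> un.
  have -> : 2 * (1 + c * u ^+ 1) - 1 * (c * u ^+ 1) * (1 - u)
     = 2 + c * u + c * u ^+ 2 by ring.
  have -> : c * u ^+ 1 * (1 * (1 - u) + 2 * u * (1 + c * u ^+ 1))
    = c * u * (1 + u + 2 * c * u ^+ 2) by ring.
  apply: le_lt_trans (reciprocal_quadratic_lt u1 c1).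
  by rewrite !cmodM c1 mul1r ler_piMl ?cmod_ge0 // ltW.
have -> : 2 * (1 + c * u ^+ 2) - 2 * (c * u ^+ 2) * (1 - u) = 2 * (1 + c * u ^+ 3).
  by ring.
have -> : c * u ^+ 2 * (2 * (1 - u) + 2 * u * (1 + c * u ^+ 2))
  = c * u ^+ 2 * (2 * (1 + c * u ^+ 3)) by ring.
rewrite (cmodM (c * u ^+ 2)) gtr_pMl // cmod_gt0 mulf_neq0 ?pnatr_eq0 //.
by rewrite nonzero_1D // cmodM c1 mul1r cmodX expr_lt1 ?cmod_ge0.
Qed.

(** The three linear relations between h', z h'' and z g'', rewritten in the
    variable u = xz: the half-plane identity differentiated once and twice, and
    the differentiated equation g' = e z^n h'. *)
Lemma dilatation_relations (x y e z p h2 g2 : C) (n : nat) :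
  (n = 1%N \/ n = 2%N) -> x * y = 1 ->
  x * p + y * (e * z ^+ n * p) = x * (1 - x * z)^-1 ^+ 2 ->
  x * h2 + y * g2 = 2 * x ^+ 2 * (1 - x * z)^-1 ^+ 3 ->
  z * g2 = e * z ^+ n * (n%:R * p + z * h2) ->
  let w := y ^+ 2 * e * y ^+ n * (x * z) ^+ n in
  [/\ (1 + w) * p = (1 - x * z)^-1 ^+ 2,
      z * h2 + y ^+ 2 * (z * g2) = 2 * (x * z) * (1 - x * z)^-1 ^+ 3 &
      y ^+ 2 * (z * g2) = n%:R * w * p + w * (z * h2)].
Proof.
move=> n12 xy E1 E2 E3 w.
have wE : w = y ^+ 2 * (e * z ^+ n).
  transitivity (y ^+ 2 * (e * z ^+ n) * (x * y) ^+ n); last first.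
    by rewrite xy expr1n mulr1.
  by rewrite /w !exprMn; ring.
clearbody w; split.
- transitivity (y * (x * (1 - x * z)^-1 ^+ 2)); last first.
    by rewrite mulrA (mulrC y) xy mul1r.
  rewrite -E1 wE.
  transitivity ((x * y) * p + y ^+ 2 * (e * z ^+ n) * p); last by ring.
  by rewrite xy; ring.
- transitivity (x * y * (2 * (x * z) * (1 - x * z)^-1 ^+ 3)); last first.
    by rewrite xy mul1r.
  transitivity (y * z * (2 * x ^+ 2 * (1 - x * z)^-1 ^+ 3)); last by ring.
  rewrite -E2.
  transitivity ((x * y) * (z * h2) + y ^+ 2 * (z * g2)); last by ring.
  by rewrite xy; ring.
- by rewrite E3 wE; ring.
Qed.

(** In the coordinate v = u / (1 - u), the derivative of the shear of the convolution
    is 1 / (1 + w) + v, where w is x^-2 times the dilatation of f. *)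
Lemma shear_value (u w p s q : C) : 1 - u != 0 -> 1 + w != 0 ->
  (1 + w) * p = (1 - u)^-1 ^+ 2 -> s + q = 2 * u * (1 - u)^-1 ^+ 3 ->
  2^-1 * (2 * p + (s + q)) * (1 - u) ^+ 2 = (1 + w)^-1 + ((1 - u)^-1 - 1).
Proof.
move=> u0 w0 E1 ->.
have -> : p = (1 - u)^-1 ^+ 2 / (1 + w) by rewrite -E1; field.
by field; rewrite u0.
Qed.

Lemma shear_estimates (x y e z p h2 g2 : C) (n : nat) :
  (n = 1%N \/ n = 2%N) -> x * y = 1 -> cmod x = 1 -> cmod y = 1 -> cmod e = 1 ->
  cmod z < 1 ->
  x * p + y * (e * z ^+ n * p) = x * (1 - x * z)^-1 ^+ 2 ->
  x * h2 + y * g2 = 2 * x ^+ 2 * (1 - x * z)^-1 ^+ 3 ->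
  z * g2 = e * z ^+ n * (n%:R * p + z * h2) ->
  let H1 := 2^-1 * (2 * p + z * h2) in
  let G1 := - 2^-1 * (z * g2) in
  cmod G1 < cmod H1 /\
  Re (1 - x * z)^-1 - 2^-1 <= Re ((H1 - y ^+ 2 * G1) * (1 - x * z) ^+ 2).
Proof.
move=> n12 xy x1 y1 e1 z1 D1 D2 D3 H1 G1.
have [] := dilatation_relations n12 xy D1 D2 D3.
have xz1 : cmod (x * z) < 1 by rewrite cmodM x1 mul1r.
set c := y ^+ 2 * e * y ^+ n.
have c1 : cmod c = 1 by rewrite !cmodM !cmodX y1 e1 !expr1n !mulr1.
have wn : cmod (c * (x * z) ^+ n) < 1.
  rewrite cmodM c1 mul1r cmodX expr_lt1 ?cmod_ge0 //.
  by case: n12 => ->.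
move=> E1 E2 E3; rewrite /H1 /G1; split.
  have -> : cmod (- 2^-1 * (z * g2)) = cmod 2^-1 * cmod (y ^+ 2 * (z * g2)).
    by rewrite (cmodM (- 2^-1)) cmodN (cmodM (y ^+ 2)) cmodX y1 expr1n mul1r.
  rewrite (cmodM 2^-1) ltr_pM2l ?cmod_gt0 ?invr_eq0 ?pnatr_eq0 //.
  exact: conv_dilatation_lt n12 xz1 c1 E1 E2 E3.
have -> : 2^-1 * (2 * p + z * h2) - y ^+ 2 * (- 2^-1 * (z * g2))
   = 2^-1 * (2 * p + (z * h2 + y ^+ 2 * (z * g2))) by ring.
rewrite (shear_value (nonzero_1B xz1) (nonzero_1D wn) E1 E2).
have := Re_inv1D wn.
by rewrite !cReD cReN /=; lra.
Qed.

Section HalfPlane.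
Variables (x y e : C) (n : nat) (h g : C -> C) (a b : nat -> C).
Hypothesis n12 : n = 1%N \/ n = 2%N.
Hypothesis x1 : cmod x = 1.
Hypothesis yE : y = x^*.
Hypothesis e1 : cmod e = 1.
Hypothesis ah : pow_series a h.
Hypothesis bg : pow_series b g.
Hypothesis a0 : a 0 = 0.
Hypothesis a1 : a 1 = 1.
Hypothesis b0 : b 0 = 0.
Hypothesis b1 : b 1 = 0.
Hypothesis dil : forall z : C, cmod z < 1 ->
  derive1 g z = e * z ^+ n * derive1 h z.
Hypothesis in_half_plane : forall z : C, cmod z < 1 ->
  - 2^-1 < Re (x * (h z + (g z)^*)).

Let xy : x * y = 1. Proof. by rewrite yE; exact: unimod_mulJ. Qed.
Let y1 : cmod y = 1. Proof. by rewrite yE cmodJ. Qed.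

(** The analytic function on the left has the same real part as x f, so its values
    lie in the half-plane Re > -1/2, and its derivative at 0 is x because b 1 = 0:
    it is the extremal function. *)
Lemma half_plane_combination (z : C) : cmod z < 1 ->
  x * h z + y * g z = (1 - x * z)^-1 ^+ 1 + -1.
Proof.
have FS : pow_series (fun n => x * a n + y * b n) (fun z => x * h z + y * g z).
  by apply: pow_seriesD; exact: pow_seriesZ.
have FRe (w : C) : cmod w < 1 -> - 2^-1 < Re (x * h w + y * g w).
  move=> w1; have := in_half_plane w1.
  rewrite mulrDr !cReD.
  suff -> : Re (x * (g w)^*) = Re (y * g w) by [].
  by rewrite yE !cReM !cReJ !cImJ; ring.
have A0 : x * a 0 + y * b 0 = 0 by rewrite a0 b0 !mulr0 addr0.
have A1 : x * a 1 + y * b 1 = x by rewrite a1 b1 mulr1 mulr0 addr0.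
have aE k : (0 < k)%N -> x * a k + y * b k = x ^+ k.
  exact: (caratheodory_extremal FS FRe A0 A1 x1).
have GS : pow_series (fun n => x * a n + y * b n) (fun z => (1 - x * z)^-1 + -1).
  have GS := pow_seriesD (pow_series_geom_scaled x1) (@pow_series_cst R (-1)).
  apply: pow_series_eq GS => [|//].
  case=> [|k]; first by rewrite A0 expr0 subrr.
  by rewrite addr0 aE.
exact: (pow_series_unique FS GS).
Qed.

Lemma half_plane_combination_derive1 (z : C) : cmod z < 1 ->
  x * derive1 h z + y * derive1 g z = x * (1 - x * z)^-1 ^+ 2.
Proof.
move=> z1; have xz : 1 - x * z != 0 by rewrite nonzero_1B // cmodM x1 mul1r.
have := derive1_eq_disk half_plane_combination z1.
have dh := pow_series_is_derive ah z1; have dg := pow_series_is_derive bg z1.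
rewrite (is_derive_derive1
  (cderiv_add (cderiv_scale x dh) (cderiv_scale y dg))) => ->.
rewrite (is_derive_derive1
  (cderiv_add (is_derive_inv1B 1 xz) (is_derive_cst (-1 : C) z 1))).
by rewrite mul1r addr0.
Qed.

Lemma half_plane_combination_derive2 (z : C) : cmod z < 1 ->
  x * derive1 (derive1 h) z + y * derive1 (derive1 g) z
    = 2 * x ^+ 2 * (1 - x * z)^-1 ^+ 3.
Proof.
move=> z1; have xz : 1 - x * z != 0 by rewrite nonzero_1B // cmodM x1 mul1r.
have := derive1_eq_disk half_plane_combination_derive1 z1.
have dh := pow_series_is_derive (pow_series_derive1 ah) z1.
have dg := pow_series_is_derive (pow_series_derive1 bg) z1.
rewrite (is_derive_derive1
  (cderiv_add (cderiv_scale x dh) (cderiv_scale y dg))) => ->.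
rewrite (is_derive_derive1 (cderiv_scale x (is_derive_inv1B 2 xz))).
by ring.
Qed.

Lemma dilatation_derive (z : C) : cmod z < 1 ->
  z * derive1 (derive1 g) z
    = e * z ^+ n * (n%:R * derive1 h z + z * derive1 (derive1 h) z).
Proof.
move=> z1; have dh := pow_series_is_derive (pow_series_derive1 ah) z1.
have E := etrans (derive1_eq_disk dil z1)
  (is_derive_derive1 (cderiv_mul (cderiv_scale e (cderiv_exp n z)) dh)).
have alg (p q : C) : z * (e * z ^+ n * p + q * (e * (n%:R * z ^+ n.-1)))
    = e * z ^+ n * (n%:R * q + z * p).
  by case: n12 => ->; rewrite /= ?expr0 ?expr1; ring.
exact: etrans (congr1 (fun t => z * t) E) (alg _ _).
Qed.

Let H := hadamard (analytic_part (f0 R)) h.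
Let G := hadamard (coanalytic_part (f0 R)) g.

Lemma convolution_shear (z : C) : cmod z < 1 ->
  cmod (derive1 G z) < cmod (derive1 H z) /\
  Re (1 - x * z)^-1 - 2^-1
    <= Re ((derive1 H z - y ^+ 2 * derive1 G z) * (1 - x * z) ^+ 2).
Proof.
move=> z1; rewrite (derive1_hadamard_h0 ah a0 z1) (derive1_hadamard_g0 bg b0 z1).
have E1 := half_plane_combination_derive1 z1; rewrite (dil z1) in E1.
exact: (shear_estimates n12 xy x1 y1 e1 z1 E1 (half_plane_combination_derive2 z1)
  (dilatation_derive z1)).
Qed.

End HalfPlane.

End Dilatation.

Theorem theorem1 (R : realType) (gamma theta : R) (n : nat)
    (f : harmonic_map R) :
  0 <= gamma < 2 * pi ->
  (n = 1%N \/ n = 2%N) ->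
  class_SH0_half_plane gamma f ->
  (forall z : Cplx R, unit_disk z ->
     dilatation f z = expi theta * z ^+ n) ->
  class_SH0 (convolution (f0 R) f) /\
  map_convex_in_direction (- gamma) (convolution (f0 R) f).
Proof.
move=> _ n12 [[[[_ [hS gS] a0 a1 b0] _ fsp] b1] fD] fdil.
have ah := has_taylor_pow_series hS; have bg := has_taylor_pow_series gS.
set h := analytic_part f in ah a0 a1 hS *.
set g := coanalytic_part f in bg b0 b1 gS *.
have x1 := cmod_expi gamma.
have dil (z : Cplx R) : cmod z < 1 ->
    derive1 g z = expi theta * z ^+ n * derive1 h z.
  move=> z1; rewrite -fdil ?unit_diskE // /dilatation divfK // -cmod_gt0.
  have /sense_preserving_cmod /(_ z z1) := fsp.
  exact: le_lt_trans (cmod_ge0 _).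
have hp (z : Cplx R) : cmod z < 1 ->
    - 2^-1 < complex.Re (expi gamma * (h z + (g z)^*)).
  move=> z1; have : half_plane gamma (f z).
    by rewrite -fD; exists z => //; rewrite unit_diskE.
  exact.
have sh := convolution_shear n12 x1 erefl (cmod_expi theta) ah bg a0 a1 b0 b1 dil hp.
have HS := (pow_series_hadamard_h0 ah a0).1.
have GS := (pow_series_hadamard_g0 bg b0).1.
have dH z := pow_series_is_derive (z := z) HS.
have dG z := pow_series_is_derive (z := z) GS.
have sh1 z z1 := (sh z z1).1; have sh2 z z1 := (sh z z1).2.
split.
- split; last by rewrite (pow_series_taylor_coef _ GS) subrr !mul0r.
  split.
  + split.
    * by split; [exact: pow_series_analytic HS|exact: pow_series_analytic GS].
    * by split; [exact: pow_series_taylor HS|exact: pow_series_taylor GS].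
    * by rewrite (pow_series_taylor_coef _ HS) a0 mulr0.
    * by rewrite (pow_series_taylor_coef _ HS) a1; field.
    * by rewrite (pow_series_taylor_coef _ GS) b0 mulr0.
  + move=> z1 z2; rewrite !inE !unit_diskE => h1 h2 E.
    exact: (disk_shear_injective x1 erefl dH dG sh1 sh2 h1 h2 E).
  + by apply/sense_preserving_cmod => z z1; exact: sh1.
- move=> c; left.
  have := disk_shear_connected (c := c) x1 erefl dH dG sh1 sh2.
  set T := (X in connected X) => cT.
  suff <- : T = convolution (f0 R) f @` @unit_disk R `&` line c (- gamma).
    exact: cT.
  apply/seteqP; split => w /=.
    move=> [[z z1 <-] [t E]]; split; first by exists z => //; rewrite unit_diskE.
    by exists t => //; rewrite E expi_conj.
  move=> [[z]]; rewrite unit_diskE => z1 <- [t _ E]; split; first by exists z.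
  by exists t; rewrite -E expi_conj.
Qed.
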